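(* Let $\mathbb{F}$ be a field of characteristic zero and let $\varepsilon > 0$ be a fixed constant. Assume there is a $p$-family $(f_n)_{n\in\mathbb{N}} \in \mathsf{VP}$ such that $f_n$ requires arithmetic branching programs of size $n^{\omega(1)}$. Then there is an explicit sequence of polynomial maps $\mathcal{G} = (\mathcal{G}_n : \mathbb{F}^{n - n^{1-\varepsilon}} \to \mathbb{F}^n)_{n\in\mathbb{N}}$ such that $\mathcal{G}$ is a $\mathsf{VNC}^0$-computable hitting set generator for $\mathsf{VBP}$.
   Context: An arithmetic circuit over a field is a directed acyclic graph whose in-degree-zero vertices (input gates) are labeled by variables or field constants and whose other vertices (internal gates) are labeled $+$ or $\times$; its size is the number of internal gates. An arithmetic branching program is a layered DAG with a single source $s$ and single sink $t$, each edge labeled by an affine linear polynomial, computing $\sum_{P: s\rightsquigarrow t}\prod_{e\in P}\ell_e(\vec x)$; its size is its number of vertices. A $p$-family is a sequence of polynomials $(f_n)_n$ over $\mathbb{F}$ with $\deg f_n$ polynomially bounded in $n$. $\mathsf{VP}$ (resp. $\mathsf{VBP}$, $\mathsf{VNC}^0$) is the class of $p$-families with $f_n$ computable by circuits of size $n^{O(1)}$ (resp. branching programs of size $n^{O(1)}$, circuits of size $O(1)$). For a sequence of polynomial maps $\mathcal{G} = (\mathcal{G}_n : \mathbb{F}^{\ell(n)} \to \mathbb{F}^n)_{n}$ with $\mathcal{G}_n = (g_{n,1},\ldots,g_{n,n})$, and classes $\mathscr{C},\mathscr{D}$ of $p$-families, $\mathcal{G}$ is a $\mathscr{D}$-computable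 hitting set generator for $\mathscr{C}$ if (1) every $p$-family of the form $(g_{n,i_n})_{n}$ lies in $\mathscr{D}$, and (2) for every $p$-family $(f_n)_n \in \mathscr{C}$ and all sufficiently large $n$, $f_n \circ \mathcal{G}_{m(n)} = 0$ if and only if $f_n = 0$, where $m(n)$ is the number of variables of $f_n$.
   Formalization: Condition (2) is required only for families whose number of variables satisfies n ≤ m(n)^c + c for some c; without this, a constant family equal to an annihilator of one G_{n0} lies in VBP and defeats every generator with seed shorter than its output. *)

(* Defs.v *)
From mathcomp Require Import all_boot all_order all_algebra.
From mathcomp Require Import mpoly.
From mathcomp Require Import reals exp.

Set Implicit Arguments.
Unset Strict Implicit.
Unset Printing Implicit Defensive.

Import GRing.Theory Num.Theory.
Local Open Scope ring_scope.

(* s(n) = n^{O(1)}; the additive constant accounts for n = 0 and n = 1. *)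
Definition poly_bounded (s : nat -> nat) : Prop :=
  exists c : nat, forall n : nat, (s n <= n ^ c + c)%N.

(** * Arithmetic circuits *)

(* Circuits are given with their internal gates listed in a topological order:
   an operand of a gate is an input gate (variable or constant) or an internal
   gate that occurs earlier in the list. Internal gates have fan-in two, and
   both operands may be the same gate. *)
Inductive gate_op := PlusGate | TimesGate.

Inductive operand (F : Type) (m : nat) :=
  | VarInput of 'I_m
  | ConstInput of F
  | InternalGate of nat.

Definition operand_below (F : Type) (m : nat) (i : nat) (a : operand F m) :
    bool :=
  if a is InternalGate j then (j < i)%N else true.

Record circuit (F : Type) (m : nat) := Circuit {
  gates : seq (gate_op * operand F m * operand F m);
  output : operand F m;
  gates_acyclic : forall (i : nat) g0, (i < size gates)%N ->
    let: (_, a, b) := nth g0 gates i in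
    operand_below i a && operand_below i b;
  output_valid : operand_below (size gates) output
}.

Definition circuit_size (F : Type) (m : nat) (C : circuit F m) : nat :=
  size (gates C).

Section CircuitSemantics.
Variables (F : fieldType) (m : nat).

Definition operand_poly (vals : seq {mpoly F[m]}) (a : operand F m) :
    {mpoly F[m]} :=
  match a with
  | VarInput i => 'X_i
  | ConstInput c => c%:MP
  | InternalGate j => vals`_j
  end.

Definition gate_poly (vals : seq {mpoly F[m]})
    (g : gate_op * operand F m * operand F m) : {mpoly F[m]} :=
  let: (op, a, b) := g in
  match op with
  | PlusGate => operand_poly vals a + operand_poly vals b
  | TimesGate => operand_poly vals a * operand_poly vals b
  end.

Definition gates_polys (gs : seq (gate_op * operand F m * operand F m)) :
    seq {mpoly F[m]} :=
  foldl (fun vals g => rcons vals (gate_poly vals g)) [::] gs.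

Definition circuit_poly (C : circuit F m) : {mpoly F[m]} :=
  operand_poly (gates_polys (gates C)) (output C).

End CircuitSemantics.

(** * Arithmetic branching programs *)

(* A branching program with k vertices over m variables; edges go from one
   layer to the next. [msize p] is 1 + deg p, and 0 for p = 0, so that
   [msize p <= 2] says that p is affine linear. *)
Record abp (F : fieldType) (m k : nat) := ABP {
  abp_edge : rel 'I_k;
  abp_label : 'I_k -> 'I_k -> {mpoly F[m]};
  abp_layer : 'I_k -> nat;
  abp_source : 'I_k;
  abp_sink : 'I_k;
  abp_layered : forall u v, abp_edge u v -> abp_layer v = (abp_layer u).+1;
  abp_affine : forall u v, abp_edge u v -> (msize (abp_label u v) <= 2)%N;
  abp_single_source : forall v, (forall u, ~~ abp_edge u v) <-> v = abp_source;
  abp_single_sink : forall v, (forall w, ~~ abp_edge v w) <-> v = abp_sink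
}.

(* The sum runs over all paths from source to sink: since the graph is acyclic,
   a path has fewer than k edges. A path with d edges is represented by the
   d-tuple of its vertices other than the source. *)
Definition abp_poly (F : fieldType) (m k : nat) (B : abp F m k) :
    {mpoly F[m]} :=
  \sum_(d < k)
    \sum_(p : d.-tuple 'I_k | path (abp_edge B) (abp_source B) p
                              && (last (abp_source B) p == abp_sink B))
      \prod_(e <- zip (abp_source B :: p) p) abp_label B e.1 e.2.

(** * Families of polynomials and complexity classes *)

Record poly_seq (F : fieldType) := PolySeq {
  nvars : nat -> nat;
  poly_term :> forall n : nat, {mpoly F[nvars n]}
}.

Definition p_family (F : fieldType) (f : poly_seq F) : Prop :=
  poly_bounded (fun n => (msize (f n)).-1).

Definition circuits_of_size (F : fieldType) (s : nat -> nat) (f : poly_seq F) :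
    Prop :=
  forall n, exists2 C : circuit F (nvars f n),
    circuit_poly C = f n & (circuit_size C <= s n)%N.

Definition abps_of_size (F : fieldType) (s : nat -> nat) (f : poly_seq F) :
    Prop :=
  forall n, exists2 k : nat, (k <= s n)%N &
    exists B : abp F (nvars f n) k, abp_poly B = f n.

Definition VP (F : fieldType) (f : poly_seq F) : Prop :=
  p_family f /\ exists2 s, poly_bounded s & circuits_of_size s f.

Definition VBP (F : fieldType) (f : poly_seq F) : Prop :=
  p_family f /\ exists2 s, poly_bounded s & abps_of_size s f.

Definition VNC0 (F : fieldType) (f : poly_seq F) : Prop :=
  p_family f /\ exists c : nat, circuits_of_size (fun=> c) f.

(* f_n requires branching programs of size n^{omega(1)}: the least size of a
   branching program for f_n eventually exceeds every polynomial in n. *)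
Definition requires_superpoly_abps (F : fieldType) (f : poly_seq F) : Prop :=
  forall c : nat, exists N : nat, forall n : nat, (N <= n)%N ->
    forall (k : nat) (B : abp F (nvars f n) k), abp_poly B = f n ->
      (n ^ c <= k)%N.

(** * Hitting set generators *)

(* A polynomial map F^l -> F^n, given by its n coordinate polynomials. *)
Definition poly_map (F : fieldType) (l n : nat) := n.-tuple {mpoly F[l]}.

(* The family (g_{n,i_n})_n. The map G_0 has no coordinates, so the term at
   n = 0 is set to 0. *)
Definition coord_seq (F : fieldType) (l : nat -> nat)
    (G : forall n, poly_map F (l n) n) (i : nat -> nat) : poly_seq F :=
  PolySeq (fun n => nth 0 (G n) (i n)).

(* In the second clause, the number m(n) of variables of f_n has to grow at
   least like n^{Omega(1)}. Without this condition no generator with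
   l(n) < n for some n >= 1 would hit even the families constant in n: a nonzero
   polynomial A in n variables that vanishes on G_n, seen as the family with
   f_k = A for all k, would be a counterexample. *)
Definition hitting_set_generator (F : fieldType)
    (D C : poly_seq F -> Prop) (l : nat -> nat)
    (G : forall n, poly_map F (l n) n) : Prop :=
  (forall i : nat -> nat, (forall n, (0 < n)%N -> (i n < n)%N) ->
     D (coord_seq G i)) /\
  (forall f : poly_seq F, C f ->
     (exists c : nat, forall n : nat, (n <= nvars f n ^ c + c)%N) ->
     exists N : nat, forall n : nat, (N <= n)%N ->
       (f n \mPo G (nvars f n) = 0 <-> f n = 0)).

(* The integer part of n - n^{1 - eps}. *)
Definition seed_length (R : realType) (eps : R) (n : nat) : nat :=
  Num.truncn (n%:R - n%:R `^ (1 - eps)).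

(* Main.v *)
Require Import Defs.
From mathcomp Require Import all_boot all_order all_algebra.
From mathcomp Require Import mpoly.
From mathcomp Require Import reals exp.
From mathcomp Require Import boolp.
From mathcomp Require Import zify ring lra.

(* Let [f] be computed by a circuit with gates [g_1, ..., g_s], and let
   [Phi(x, z)] be the output of the circuit when [z_i] is added to the value of
   its gate [i]; then [Phi(x, 0) = f(x)]. The graph of [Phi] is the image of
   [(x, y) |-> (x, y_i - g_i(x, y), y_out)], whose coordinates have constant-size
   circuits. The generator consists of about [n^(1 - eps)] disjoint copies of
   this map, and it copies its remaining seeds.

   If a nonzero [P] vanishes on the generator, a hybrid argument on points that
   replaces one block at a time gives an affine instance [Q(X, w) <> 0] of [P]
   with [Q(X, Phi(X)) = 0]. Write [Q = (w - Phi)^e H] with [H(X, Phi(X)) <> 0] and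
   restrict to a line [X(tau)] that starts where [H(X, Phi(X))] does not vanish.
   After moving the root to the origin and normalizing, Lagrange inversion for
   roots of multiplicity [e] gives
     [e [tau^i] Phi = sum_m 1/m [tau^i w^(e m - 1)] phi^m],  [phi = w^e - Q].
   By interpolation [Phi] is thus a linear combination of products of affine
   instances of [Q], so if [P] has small branching programs, so has [f]. *)

Set Implicit Arguments.
Unset Strict Implicit.
Unset Printing Implicit Defensive.

Import Order.TTheory GRing.Theory Num.Theory.
Local Open Scope ring_scope.

(** * Iterated products of affine matrices and branching programs *)

Section IteratedMatrixProduct.
Variables (F : fieldType) (n : nat).
Local Notation P := {mpoly F[n]}.
Local Notation CC := (map_mx (@mpolyC n F)).

Definition mxprod (W : nat) (Ms : seq 'M[P]_W) : 'M[P]_W := foldr mulmx 1%:M Ms.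

Definition affine_mxs (W : nat) (Ms : seq 'M[P]_W) : Prop :=
  {in Ms, forall M : 'M[P]_W, forall i j, (msize (M i j) <= 2)%N}.

(** Iterated matrix multiplication of width [W] and length [L]: a normal form of branching programs,
    closed under sums, products and affine substitutions without any bookkeeping of layers. *)
Definition imm (W L : nat) (p : P) : Prop :=
  exists (r : 'rV[F]_W) (c : 'cV[F]_W) (Ms : seq 'M[P]_W),
    [/\ size Ms = L, affine_mxs Ms & p = (CC r *m mxprod Ms *m CC c) 0 0].

Lemma mxprod_cat W (s1 s2 : seq 'M[P]_W) :
  mxprod (s1 ++ s2) = mxprod s1 *m mxprod s2.
Proof.
elim: s1 => [|M s1 IH] /=; first by rewrite mul1mx.
by rewrite [mxprod (s1 ++ s2)]IH mulmxA.
Qed.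

Lemma msizeC_le2 (c : F) : (msize (c%:MP : P) <= 2)%N.
Proof. by rewrite msizeC; case: eqP. Qed.

Lemma affine_mxs_cat W (s1 s2 : seq 'M[P]_W) :
  affine_mxs s1 -> affine_mxs s2 -> affine_mxs (s1 ++ s2).
Proof. by move=> h1 h2 M; rewrite mem_cat => /orP[/h1|/h2]. Qed.

Lemma affine_mxs_CC W (s : seq 'M[P]_W) :
  (forall M, M \in s -> exists N, M = CC N) -> affine_mxs s.
Proof. by move=> h M /h[N ->] i j; rewrite mxE msizeC_le2. Qed.

Lemma imm_scale W L (a : F) p : imm W L p -> imm W L (a *: p).
Proof.
move=> [r [c [Ms [sM aM ->]]]]; exists (a *: r), c, Ms; split=> //.
have -> : CC (a *: r) = a%:MP *: CC r.
  by apply/matrixP => i j; rewrite !mxE mpolyCM.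
by rewrite -!scalemxAl [RHS]mxE mul_mpolyC.
Qed.

(** The constant rank-one matrix [c *m r'] joins the two products and adds one to the length. *)
Lemma imm_mul W L1 L2 p q :
  imm W L1 p -> imm W L2 q -> imm W (L1 + L2).+1 (p * q).
Proof.
move=> [r [c [Ms [sM aM ->]]]] [r' [c' [Ms' [sM' aM' ->]]]].
exists r, c', (Ms ++ CC (c *m r') :: Ms'); split.
- by rewrite size_cat /= sM sM' addnS.
- apply: affine_mxs_cat => // M; rewrite inE => /orP[/eqP->|/aM'] //.
  by move=> i j; rewrite mxE msizeC_le2.
rewrite mxprod_cat /= -/(mxprod Ms') map_mxM.
set A := CC r *m _ *m CC c; set B := CC r' *m _ *m CC c'.
have -> : CC r *m (mxprod Ms *m (CC c *m CC r' *m mxprod Ms')) *m CC c' = A *m B.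
  by rewrite !mulmxA.
by rewrite [RHS]mxE big_ord1.
Qed.

Lemma imm_const W L (a : F) : imm W.+1 L a%:MP.
Proof.
exists (\row_j (a *+ (j == 0))), (\col_j ((j == 0)%:R)), (nseq L 1%:M); split.
- by rewrite size_nseq.
- apply: affine_mxs_CC => M /nseqP[-> _]; exists 1%:M.
  by rewrite map_mx1.
have -> : mxprod (nseq L 1%:M) = 1%:M :> 'M[P]_W.+1.
  by elim: L => //= L IH; rewrite [mxprod _]IH mul1mx.
rewrite mulmx1 mxE big_ord_recl !mxE eqxx mulr1n mulr1n mpolyC1 mulr1 big1 ?addr0 //.
by move=> i _; rewrite !mxE mulr0n mpolyC0 mul0r.
Qed.

Lemma imm0 W L : imm W L 0.
Proof.
exists 0, 0, (nseq L 0); split.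
- by rewrite size_nseq.
- apply: affine_mxs_CC => M /nseqP[-> _]; exists 0.
  by rewrite map_mx0.
by rewrite !map_mx0 mulmx0 mxE.
Qed.

(** The two products run in parallel as block-diagonal matrices. *)
Lemma imm_add W1 W2 L p q :
  imm W1 L p -> imm W2 L q -> imm (W1 + W2) L (p + q).
Proof.
move=> [r [c [Ms [sM aM ->]]]] [r' [c' [Ms' [sM' aM' ->]]]].
pose blk (MN : 'M[P]_W1 * 'M[P]_W2) := block_mx MN.1 0 0 MN.2.
exists (row_mx r r'), (col_mx c c'), (map blk (zip Ms Ms')); split.
- by rewrite size_map size_zip sM sM' minnn.
- move=> M /mapP[[M1 M2] /= hM ->] i j.
  have /andP[h1 h2] : (M1 \in Ms) && (M2 \in Ms').
    have s12 : size Ms = size Ms' by rewrite sM.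
    rewrite -[in X in X && _](unzip1_zip (s := Ms) (t := Ms')) ?s12 //.
    rewrite -[in X in _ && X](unzip2_zip (s := Ms) (t := Ms')) ?s12 //.
    by apply/andP; split; apply/mapP; exists (M1, M2).
  rewrite /blk /=; case: (split_ordP i) => i' ->; case: (split_ordP j) => j' ->.
  + by rewrite block_mxEul aM.
  + by rewrite block_mxEur mxE msize0.
  + by rewrite block_mxEdl mxE msize0.
  + by rewrite block_mxEdr aM'.
have -> : mxprod (map blk (zip Ms Ms')) = block_mx (mxprod Ms) 0 0 (mxprod Ms').
  have : size Ms = size Ms' by rewrite sM.
  elim: Ms Ms' {sM sM' aM aM'} => [|M Ms IH] [|M' Ms'] //=.
    by move=> _; rewrite -scalar_mx_block.
  move=> [h]; rewrite /mxprod /= -/(mxprod _) -/(mxprod _) -/(mxprod _) IH // /blk /=.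
  by rewrite mulmx_block !mul0mx !mulmx0 !addr0 !add0r.
rewrite map_row_mx map_col_mx mul_row_block mul_row_col !mulmx0 addr0 add0r.
by rewrite [RHS]mxE.
Qed.

Lemma imm_mono W W' L L' p :
  (W <= W')%N -> (L <= L')%N -> imm W L p -> imm W' L' p.
Proof.
move=> hW hL hp; rewrite -(subnKC hW) -[p]addr0; apply: imm_add; last exact: imm0.
move: hp => [r [c [Ms [sM aM ->]]]].
exists r, c, (Ms ++ nseq (L' - L) 1%:M); split.
- by rewrite size_cat size_nseq sM subnKC.
- apply: affine_mxs_cat => //; apply: affine_mxs_CC => M /nseqP[-> _].
  by exists 1%:M; rewrite map_mx1.
rewrite mxprod_cat.
have -> : mxprod (nseq (L' - L) 1%:M) = 1%:M :> 'M[P]_W.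
  by elim: (L' - L)%N => //= l IH; rewrite [mxprod _]IH mul1mx.
by rewrite mulmx1.
Qed.

Lemma imm_sum W L T (p : 'I_T -> P) :
  (forall i, imm W L (p i)) -> imm (T * W) L (\sum_(i < T) p i).
Proof.
elim: T p => [|T IH] p h; first by rewrite big_ord0 mul0n; apply: imm0.
by rewrite big_ord_recr /= mulSnr; apply: imm_add; [apply: IH|].
Qed.

Lemma imm_exp W L m p : imm W.+1 L p -> imm W.+1 (m * L.+1) (p ^+ m).
Proof.
move=> hp; elim: m => [|m IH]; first by rewrite expr0 -mpolyC1; apply: imm_const.
by rewrite exprS mulSn addSn; apply: imm_mul.
Qed.

End IteratedMatrixProduct.

(** * Affine substitution in iterated matrix products *)

Section Substitution.
Variables (F : fieldType) (n n' : nat) (lq : n.-tuple {mpoly F[n']}).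
Hypothesis affine_lq : forall i, (msize (tnth lq i) <= 2)%N.

Lemma msize_affine_comp D (p : {mpoly F[n]}) :
  (msize p <= D.+1)%N -> (msize (p \mPo lq) <= D.+1)%N.
Proof.
move=> hp; rewrite comp_mpolyE; apply: leq_trans (msize_sum _ _ _) _.
apply/bigmax_leqP_seq => m hm _.
apply: leq_trans (msizeZ_le _ _) _.
apply: leq_trans (leq_trans (msize_mdeg_lt hm) hp); rewrite mdegE.
apply: (big_rec2 (fun d r => (msize r <= d.+1)%N)) => [|i d r _ hr].
  by rewrite msize1.
have leM (r1 r2 : {mpoly F[n']}) d1 d2 : (msize r1 <= d1.+1)%N -> (msize r2 <= d2.+1)%N ->
    (msize (r1 * r2) <= (d1 + d2).+1)%N.
  have [->|nz1] := eqVneq r1 0; first by rewrite mul0r msize0.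
  have [->|nz2] := eqVneq r2 0; first by rewrite mulr0 msize0.
  by rewrite msizeM //; move: (msize r1) (msize r2) => k1 k2; lia.
apply: (leM) => //; elim: (m i) => [|k IH]; first by rewrite expr0 msize1.
rewrite exprS -[k.+1]add1n; apply: leM => //; exact: affine_lq.
Qed.

Lemma imm_comp W L (p : {mpoly F[n]}) : imm W L p -> imm W L (p \mPo lq).
Proof.
move=> [r [c [Ms [sM aM ->]]]].
pose f := comp_mpoly lq.
exists r, c, (map (map_mx f) Ms); split; first by rewrite size_map.
  move=> M /mapP[M' hM' ->] i j; rewrite mxE; apply: msize_affine_comp; exact: aM.
have fC k l (B : 'M[F]_(k, l)) :
    map_mx f (map_mx (@mpolyC n F) B) = map_mx (@mpolyC n' F) B.
  by apply/matrixP => i j; rewrite !mxE /f comp_mpolyC.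
have -> : mxprod (map (map_mx f) Ms) = map_mx f (mxprod Ms).
  elim: Ms {sM aM} => [|M Ms IH] /=; first by rewrite /mxprod /= map_mx1.
  by rewrite /mxprod /= -/(mxprod _) -/(mxprod _) IH map_mxM.
by rewrite -(fC _ _ r) -(fC _ _ c) -!map_mxM [RHS]mxE.
Qed.

End Substitution.

(** * Path sums of branching programs as entries of matrix products *)

Section Walks.
Variables (A : comNzRingType) (T : finType) (edge : rel T) (label : T -> T -> A).

(** Entry [(s, t)] of the [d]-th power of the weighted adjacency matrix. *)
Fixpoint walks (d : nat) (s t : T) : A :=
  if d is d'.+1 then \sum_u (if edge s u then label s u else 0) * walks d' u t
  else (s == t)%:R.

Lemma walksE d s t :
  \sum_(p : d.-tuple T | path edge s p && (last s p == t))
      \prod_(e <- zip (s :: p) p) label e.1 e.2 = walks d s t.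
Proof.
elim: d s => [|d IH] s /=.
  rewrite big_mkcond (bigD1 [tuple]) //= [X in _ + X]big1 ?addr0.
    by case: eqP; rewrite ?big_nil.
  by move=> p /negP[]; rewrite [p]tuple0.
pose cons2 (x : T * d.-tuple T) := cons_tuple x.1 x.2.
rewrite (reindex cons2) /=; last first.
  exists (fun p => (thead p, behead_tuple p)) => [[u p] _|p _].
    by rewrite /cons2 /= theadE; congr pair; apply: val_inj.
  by rewrite [RHS]tuple_eta; apply: val_inj.
rewrite big_mkcond -(pair_bigA _ (fun u (p : d.-tuple T) =>
   if edge s u && path edge u p && (last u p == t)
   then \prod_(e <- (s, u) :: zip (u :: p) p) label e.1 e.2 else 0)) /=.
apply: eq_bigr => u _; rewrite -IH; case: (edge s u) => /=.
  rewrite mulr_sumr -big_mkcond; apply: eq_bigr => p _.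
  by rewrite big_cons.
by rewrite mul0r big1.
Qed.

End Walks.

(** An absorbing extra state, entered from the sink with weight [1], turns the sum over all path
    lengths below [k] into one entry of the [k]-th power of a single matrix. *)
Lemma imm_of_abp (F : fieldType) (n k : nat) (B : abp F n k) :
  imm k.+1 k (abp_poly B).
Proof.
case: B => edge label layer s t lay aff ss st; rewrite /abp_poly /=.
pose M : 'M[{mpoly F[n]}]_k := \matrix_(u, v) if edge u v then label u v else 0.
rewrite -addn1.
pose M1 : 'M[{mpoly F[n]}]_(k + 1) := block_mx M (map_mx (@mpolyC n F) (delta_mx t 0)) 0 1%:M.
exists (row_mx (delta_mx 0 s) 0), (col_mx 0 1%:M), (nseq k M1); split.
- by rewrite size_nseq.
- move=> _ /nseqP[-> _] i j; rewrite /M1.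
  case: (split_ordP i) => i' ->; case: (split_ordP j) => j' ->.
  + by rewrite block_mxEul mxE; case: ifP => [/aff //|_]; rewrite msize0.
  + by rewrite block_mxEur mxE msizeC_le2.
  + by rewrite block_mxEdl mxE msize0.
  + by rewrite block_mxEdr mxE -mpolyC1 -rmorphMn msizeC_le2.
under eq_bigr => d _ do rewrite walksE.
rewrite !map_row_mx !map_col_mx !map_mx0 map_mx1 -mulmxA.
have -> : forall j, mxprod (nseq j M1) *m col_mx 0 1%:M
   = col_mx (\col_u \sum_(d < j) walks edge label d u t) (1%:M : 'M_1).
  elim=> [|j IH].
    rewrite /mxprod /= mul1mx; congr col_mx.
    by apply/matrixP => u i; rewrite !mxE big_ord0.
  rewrite /mxprod /= -/(mxprod _) -mulmxA IH mul_block_col mul0mx add0r mulmx1 mulmx1.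
  congr col_mx; apply/matrixP => u i; rewrite !mxE big_ord_recl /= ord1 andbT addrC.
  rewrite [in RHS]/walks; congr (_ + _).
    by rewrite mpolyC_nat.
  rewrite exchange_big /=; apply: eq_bigr => v _.
  by rewrite !mxE mulr_sumr.
rewrite mul_row_col mul0mx addr0 [RHS]mxE [RHS](bigD1 s) //= !mxE !eqxx mpolyC1 mul1r.
rewrite [X in _ + X]big1 ?addr0 // => v vs; rewrite !mxE (negbTE vs) andbF mpolyC0 mul0r //.
Qed.

Lemma big_option (A : nmodType) (T : finType) (f : option T -> A) :
  \sum_x f x = f None + \sum_x f (Some x).
Proof.
rewrite (bigD1 None) //=; congr (_ + _).
rewrite (reindex_omap Some id) /=; last by case.
by apply: eq_bigl => x; rewrite eqxx.
Qed.

Lemma big_pair (A : nmodType) (I J : finType) (f : I * J -> A) :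
  \sum_x f x = \sum_i \sum_j f (i, j).
Proof. by rewrite pair_bigA; apply: eq_bigr => -[]. Qed.

Lemma walks_enum (A : comNzRingType) (T : finType) (edge : rel T)
    (label : T -> T -> A) (d : nat) (s t : T) :
  walks (fun i j : 'I_#|T| => edge (enum_val i) (enum_val j))
    (fun i j : 'I_#|T| => label (enum_val i) (enum_val j)) d
    (enum_rank s) (enum_rank t)
  = walks edge label d s t.
Proof.
elim: d s => [|d IH] s /=; first by rewrite (inj_eq enum_rank_inj).
rewrite [RHS](reindex (fun i : 'I_#|T| => enum_val i)) /=; last first.
  by exists enum_rank => x _; rewrite ?enum_valK ?enum_rankK.
by apply: eq_bigr => u _; rewrite enum_rankK -IH enum_valK.
Qed.

(** The program has [L.+1] layers of [W.+1] vertices between a source and a sink. All edges between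
    consecutive layers are present, zero labels included; with a positive width this makes source
    and sink unique. *)
Lemma abp_of_imm (F : fieldType) (n W L : nat) (p : {mpoly F[n]}) :
  imm W.+1 L p ->
  exists B : abp F n (L.+1 * W.+1 + 2), abp_poly B = p.
Proof.
move=> [r [c [Ms [sM aM Ep]]]].
pose V := option (option ('I_L.+1 * 'I_W.+1)).
pose src : V := Some None; pose snk : V := None.
pose layer (v : V) : nat :=
  match v with None => L.+2 | Some None => 0 | Some (Some x) => x.1.+1 end.
pose edge (u v : V) := layer v == (layer u).+1.
pose label (u v : V) : {mpoly F[n]} :=
  match u, v with
  | Some None, Some (Some x) => (r 0 x.2)%:MP
  | Some (Some x), Some (Some y) => (nth 0 Ms x.1) x.2 y.2
  | Some (Some x), None => (c x.2 0)%:MP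
  | _, _ => 0
  end.
have cV : #|{: V}| = (L.+1 * W.+1 + 2)%N.
  by rewrite !card_option card_prod !card_ord addn2.
have aff u v : edge u v -> (msize (label u v) <= 2)%N.
  case: u v => [[[i a]|]|] [[[j b]|]|] //=; rewrite ?msizeC_le2 ?msize0 //.
  rewrite /edge /= => /eqP [h].
  by apply: aM; apply: mem_nth; rewrite sM; case: j h => j /= lj; lia.
have ssrc v : (forall u, ~~ edge u v) <-> v = src.
  split=> [h|->]; last by case=> [[[i a]|]|].
  case: v h => [[[[[|i] li] a]|]|] // h.
  - by have := h src; rewrite /edge.
  - by have := h (Some (Some (inord i, a))); rewrite /edge /= inordK ?eqxx //; lia.
  - by have := h (Some (Some (ord_max, ord0))); rewrite /edge /= eqxx.
have ssnk v : (forall w, ~~ edge v w) <-> v = snk.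
  split=> [h|->].
    case: v h => [[[[i li] a]|]|] // h.
    - case: (ltnP i L) => iL.
        by have := h (Some (Some (inord i.+1, a))); rewrite /edge /= inordK ?eqxx.
      have := h snk; rewrite /edge /=; have -> : (L.+2 == i.+2) by apply/eqP; lia.
      by [].
    - by have := h (Some (Some (ord0, ord0))); rewrite /edge.
  by case=> [[[[i li] a]|]|]; rewrite /edge //=; lia.
pose ed (i j : 'I_#|{: V}|) := edge (enum_val i) (enum_val j).
pose la (i j : 'I_#|{: V}|) := label (enum_val i) (enum_val j).
have B1 : forall u v, ed u v -> layer (enum_val v) = (layer (enum_val u)).+1.
  by move=> u v /eqP.
have B2 : forall u v, ed u v -> (msize (la u v) <= 2)%N by move=> u v; apply: aff.
have B3 v : (forall u, ~~ ed u v) <-> v = enum_rank src.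
  split=> [h|->].
    apply: enum_val_inj; rewrite enum_rankK; apply/ssrc => u.
    by have := h (enum_rank u); rewrite /ed enum_rankK.
  by move=> u; rewrite /ed enum_rankK; apply: (ssrc src).2.
have B4 v : (forall w, ~~ ed v w) <-> v = enum_rank snk.
  split=> [h|->].
    apply: enum_val_inj; rewrite enum_rankK; apply/ssnk => u.
    by have := h (enum_rank u); rewrite /ed enum_rankK.
  by move=> u; rewrite /ed enum_rankK; apply: (ssnk snk).2.
rewrite -cV.
exists (@ABP F n _ ed la (fun v => layer (enum_val v)) _ _ B1 B2 B3 B4).
rewrite /abp_poly /= Ep.
under eq_bigr => d _ do rewrite walksE walks_enum.
have wsnk d : walks edge label d snk snk = (d == 0%N)%:R.
  case: d => [|d] //=.
  rewrite big1 // => u _; case: ifP => [h|_]; last by rewrite mul0r.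
  by have := (ssnk snk).2 erefl u; rewrite h.
(* Every edge climbs one layer, so layer [i.+1] reaches the sink only by walks of length exactly
   [L.+1 - i]; these carry the product of the remaining matrices. *)
have wmid d (i : 'I_L.+1) a : walks edge label d (Some (Some (i, a))) snk
    = if d == (L.+1 - i)%N then
        (mxprod (drop i Ms) *m map_mx (@mpolyC n F) c) a 0 else 0.
  elim: d i a => [|d IH] i a /=.
    by rewrite ifN //; case: i => i /= li; lia.
  rewrite !big_option /= wsnk /edge /= mul0r add0r.
  have [iL|iL] := leqP L i.
    have -> : i = L :> nat by case: i iL => i /= li; lia.
    rewrite eqxx big1 ?addr0 => [|[[j lj] b] _]; last first.
      by rewrite /= ifN ?mul0r //; lia.
    rewrite drop_oversize ?sM // mul1mx mxE.
    have -> : (d.+1 == L.+1 - L)%N = (d == 0)%N by lia.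
    by case: eqP => _; rewrite ?mulr1 ?mulr0.
  rewrite ifN; last by lia.
  rewrite mul0r add0r big_pair /=.
  have i1 : (i.+1 < L.+1)%N by [].
  rewrite (bigD1 (Ordinal i1)) //= [X in _ + X]big1 ?addr0; last first.
    by move=> j ji; rewrite big1 // => b _; rewrite ifN ?mul0r //.
  have -> : (d.+1 == L.+1 - i)%N = (d == L.+1 - i.+1)%N by lia.
  under eq_bigr => b _ do rewrite eqxx IH /=.
  case: eqP => _; last by rewrite big1 // => b _; rewrite mulr0.
  by rewrite [drop i Ms](drop_nth 0) ?sM // /mxprod /= -/(mxprod _) -mulmxA [RHS]mxE.
(* [abp_poly] sums only over lengths below the number of vertices, so [L.+2] has to lie in that
   range. *)
have hL : (L.+2 < L.+1 * W.+1 + 2)%N by nia.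
rewrite cV; transitivity (walks edge label L.+2 src snk).
  rewrite (bigD1 (Ordinal hL)) // -[RHS]addr0; congr (_ + _); apply: big1.
  move=> [[|d] ld] hd //=.
  rewrite !big_option /= /edge /= !mul0r !add0r big1 // => -[j b] _.
  rewrite wmid; case: eqP => [[h]|_]; last by rewrite mul0r.
  case: ifP => [/eqP j0|_]; last by rewrite mulr0.
  by case/eqP: hd; apply: val_inj; rewrite /= j0 h subn0.
rewrite /= !big_option /= /edge /= !mul0r !add0r.
rewrite big_pair /=.
rewrite (bigD1 ord0) //= [X in _ + X]big1 ?addr0; last first.
  move=> j j0; rewrite big1 // => b _; rewrite ifN ?mul0r //.
rewrite -mulmxA [RHS]mxE; apply: eq_bigr => b _.
have := wmid L.+1 ord0 b; rewrite /= subn0 eqxx drop0 => <-.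
by rewrite mxE.
Qed.

(** * Lagrange inversion for multiple roots *)

Section Lagrange.
Variables (A : comNzRingType) (e : nat).
Implicit Types (r u : {poly {poly A}}).

(** A lower bound on the weighted order, where the outer variable [w] has weight [1] and the inner
    variable [tau] weight [e + 1]. Then [w^e] has weight [e] but [phi] at least [e + 1], so high
    powers of [phi] become negligible. *)
Definition weight_ge n r : Prop :=
  forall j i, (j + e.+1 * i < n)%N -> r`_j`_i = 0.

Lemma weight_ge0 r : weight_ge 0 r. Proof. by move=> j i. Qed.

Lemma weight_geB n r u : weight_ge n r -> weight_ge n u -> weight_ge n (r - u).
Proof. by move=> hr hu j i h; rewrite !coefB hr // hu // subr0. Qed.

Lemma weight_geM a b r u :
  weight_ge a r -> weight_ge b u -> weight_ge (a + b) (r * u).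
Proof.
move=> hr hu j i h; rewrite coefM coef_sum big1 // => -[j' /= lj] _.
rewrite coefM big1 // => -[i' /= li] _.
case: (ltnP (j' + e.+1 * i') a) => ha; first by rewrite hr // mul0r.
by rewrite [u`_ _`_ _]hu ?mulr0 //; nia.
Qed.

Lemma weight_geMr a r u : weight_ge a r -> weight_ge a (r * u).
Proof. by move=> hr; rewrite -[a]addn0; apply: weight_geM => //; apply: weight_ge0. Qed.

Lemma weight_geX a r n : weight_ge a r -> weight_ge (a * n) (r ^+ n).
Proof.
move=> hr; elim: n => [|n IH]; first by rewrite muln0; apply: weight_ge0.
by rewrite exprS mulnS; apply: weight_geM.
Qed.

Lemma coef_exp_lt (g : {poly A}) n i : g`_0 = 0 -> (i < n)%N -> (g ^+ n)`_i = 0.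
Proof.
move=> g0; elim: n i => [|n IH] i // hi.
rewrite exprS coefM big1 // => -[[|j] /= lj] _; first by rewrite g0 mul0r.
by rewrite IH ?mulr0 //; lia.
Qed.

Lemma coefXnMpoly n r j i :
  ('X^n * r)`_j`_i = if (j < n)%N then 0 else r`_(j - n)`_i.
Proof. by rewrite coefXnM; case: ifP => // _; rewrite coef0. Qed.

Lemma coefMXnpoly n r j i :
  (r * 'X^n)`_j`_i = if (j < n)%N then 0 else r`_(j - n)`_i.
Proof. by rewrite coefMXn; case: ifP => // _; rewrite coef0. Qed.

Lemma coefBB r u j i : (r - u)`_j`_i = r`_j`_i - u`_j`_i.
Proof. by rewrite !coefB. Qed.

(* With [1/P = sum_m phi^m / w^(e (m+1))], the right-hand side is the residue of
   [w P'/P = e w / (w - g) + w H'/H], whose second term is a power series in w. *)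
Lemma residue_log_derivative (g : {poly A}) (H : {poly {poly A}}) (D K : nat) :
  let P := ('X - g%:P) ^+ e * H in
  let phi := 'X^e - P in
  (0 < e)%N -> g`_0 = 0 -> H`_0`_0 = 1 -> (e.+2 * D.+2 <= K)%N ->
  forall i, (i <= D)%N ->
  g`_i *+ e =
    (P^`() * \sum_(m < K) phi ^+ m * 'X^(e * (K.-1 - m)))`_(e * K - 2)`_i.
Proof.
move=> P phi e0 g0 H0 hK i iD.
set S := \sum_(m < K) _.
(* The finite geometric sum [S] replaces [w^(e K) / P]. *)
have PS : P * S = 'X^(e * K) - phi ^+ K.
  rewrite exprM subrXX; congr (_ * _); first by rewrite /phi; ring.
  apply: eq_bigr => -[m /= lm] _; rewrite -exprM mulrC.
  by congr (_ ^+ (_ * _) * _); lia.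
(* [w^e - (w - g)^e] is a multiple of [g], which has no constant term. In the rest, [(w - g)^e] has
   weight at least [e] and [1 - H] at least [1]. *)
have wP : weight_ge e.+1 phi.
  have wX : weight_ge e.+1 ('X^e - ('X - g%:P) ^+ e).
    rewrite subrXX; have -> : 'X - ('X - g%:P) = g%:P by ring.
    rewrite mulrC mulr_suml.
    move=> j k h; rewrite -mulr_suml mulrC coefCM.
    case: k h => [|k] h; last by lia.
    rewrite coefM big_ord1 g0 mul0r //.
  have -> : phi = ('X^e - ('X - g%:P) ^+ e) + ('X - g%:P) ^+ e * (1 - H).
    by rewrite /phi /P; ring.
  rewrite -[X in _ + X]opprK; apply: weight_geB => //; rewrite -mulrN opprB.
  rewrite -addn1; apply: weight_geM.
    rewrite -[X in weight_ge X]mul1n; apply: weight_geX => j k h.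
    have [-> ->] : j = 0%N /\ k = 0%N by lia.
    by rewrite coefB coefX coefC coefB /= coef0 g0 subr0.
  move=> j k h; have [-> ->] : j = 0%N /\ k = 0%N by lia.
  by rewrite coefB coef1 coefB /= coef1 H0 subrr.
pose M := (e.+1 * K)%N.
(* [J] inverts [H] up to weight [M], so [L] below stands for [H' / H]. *)
pose J := \sum_(m < M) (1 - H) ^+ m.
have HJ : H * J = 1 - (1 - H) ^+ M.
  rewrite -[X in X - _](expr1n _ M) subrXX; congr (_ * _); first by ring.
  by apply: eq_bigr => m _; rewrite expr1n mul1r.
have wH : weight_ge M ((1 - H) ^+ M).
  rewrite -[X in weight_ge X]mul1n; apply: weight_geX => j k h.
  have [-> ->] : j = 0%N /\ k = 0%N by lia.
  by rewrite coefB coef1 coefB /= coef1 H0 subrr.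
have wphi : weight_ge M (phi ^+ K) by apply: weight_geX.
pose L := H^`() * J.
(* The identity [P' / P = e / (w - g) + H' / H], cleared of denominators, up to weight [M]. *)
have key : weight_ge M
    (P^`() * S * ('X - g%:P) - 'X^(e * K) * (e%:R + ('X - g%:P) * L)).
  have dP : P^`() * ('X - g%:P) = P * e%:R + ('X - g%:P) ^+ e * ('X - g%:P) * H^`().
    rewrite /P derivM deriv_exp derivB derivX derivC subr0 mul1r.
    case: (e) e0 => // e' _; rewrite exprS -mulr_natr; ring.
  have E : P^`() * S * ('X - g%:P) - 'X^(e * K) * (e%:R + ('X - g%:P) * L)
     = (- phi ^+ K) * (e%:R + ('X - g%:P) * L)
       + (1 - H) ^+ M * (('X - g%:P) ^+ e * ('X - g%:P) * H^`() * S).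
    have -> : P^`() * S * ('X - g%:P) =
        (P * e%:R + ('X - g%:P) ^+ e * ('X - g%:P) * H^`()) * S.
      by rewrite -dP; ring.
    have -> : (1 - H) ^+ M = 1 - H * J by rewrite HJ; ring.
    have -> : - phi ^+ K = P * S - 'X^(e * K) by rewrite PS; ring.
    rewrite /L /P; ring.
  rewrite E -[X in _ + X]opprK -mulNr; apply: weight_geB.
    by apply: weight_geMr; rewrite -sub0r; apply: weight_geB => // j k _; rewrite !coef0.
  by rewrite mulNr -mulrN; apply: weight_geMr.
(* [G] inverts [w - g] up to [g^T], which is divisible by [tau^T] and so invisible for [i <= D]. At
   [w^D] only the term [l = 1] of [G] contributes, and it is [g]. *)
pose T := D.+2.
pose G := \sum_(l < T) 'X^(T.-1 - l) * g%:P ^+ l.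
have XG : ('X - g%:P) * G = 'X^T - g%:P ^+ T.
  by rewrite subrXX; congr (_ * _); apply: eq_bigr => -[l ll] _.
have {}key : weight_ge M (P^`() * S * ('X^T - g%:P ^+ T)
    - 'X^(e * K) * (e%:R * G + ('X^T - g%:P ^+ T) * L)).
  move: (weight_geMr G key); congr weight_ge.
  by rewrite -XG; ring.
have gT r j : (r * g%:P ^+ T)`_j`_i = 0.
  rewrite -polyC_exp coefMC coefM big1 // => -[k /= lk] _.
  by rewrite coef_exp_lt ?mulr0 // /T; lia.
(* The lower bound on [K] keeps this coefficient below weight [M]. *)
have := key (e * K - 2 + T)%N i.
have hlt : (e * K - 2 + T + e.+1 * i < M)%N by rewrite /M /T; nia.
move/(_ hlt); rewrite coefB coefB => /eqP; rewrite subr_eq0 => /eqP.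
have -> : (P^`() * S * ('X^T - g%:P ^+ T))`_(e * K - 2 + T)`_i
        = (P^`() * S)`_(e * K - 2)`_i.
  rewrite (mulrBr (P^`() * S)) coefBB (gT (P^`() * S) (e * K - 2 + T)%N) subr0 coefMXnpoly.
  rewrite ifN; last by lia.
  by rewrite addnK.
move=> ->; rewrite coefXnMpoly ifN; last by rewrite /T; lia.
have -> : (e * K - 2 + T - e * K = D)%N by rewrite /T; nia.
rewrite coefD coefD (mulrBl L) coefBB coefXnMpoly ifT; last by rewrite /T; lia.
rewrite (mulrC (g%:P ^+ T) L) gT subr0 addr0 mulr_natl coefMn coefMn; congr (_ *+ _).
rewrite /G coef_sum coef_sum (bigD1 (inord 1 : 'I_T)) //= big1 => [|l hl].
  rewrite addr0 inordK // expr1 coefXnMpoly coefC /T.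
  by rewrite ifN; [rewrite ifT //|]; lia.
rewrite coefXnMpoly; case: ifP => // h1.
rewrite -polyC_exp coefC ifN ?coef0 //.
have : l != 1%N :> nat by apply: contra hl => /eqP h; apply/eqP/val_inj; rewrite /= inordK.
by move: h1; case: l {hl} => l /= ll; rewrite /T in ll *; lia.
Qed.

End Lagrange.

Section Inversion.
Variables (F : fieldType) (A : comAlgType F).
Hypothesis F0 : [pchar F] =i pred0.

(* The constants are those of Lagrange inversion, [1 / (e m)]. *)
Lemma root_as_coefs (e D K : nat) : (0 < e)%N -> (e.+2 * D.+2 <= K)%N ->
  exists mu : nat -> F, forall (g : {poly A}) (H : {poly {poly A}}),
  g`_0 = 0 -> H`_0`_0 = 1 -> forall i, (i <= D)%N ->
  g`_i = \sum_(m < K.+1)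
    mu m *: (('X^e - ('X - g%:P) ^+ e * H) ^+ m)`_(e * m - 1)`_i.
Proof.
move=> e0 hK.
have nz n : n.+1%:R != 0 :> F by rewrite (pcharf0P F).1.
(* For [0 < m < K] this is [1 / (e m)]. The first part comes from the derivative of [w^e], the
   second from that of [phi]; at [m = K] only the second remains. *)
pose mu m : F := e%:R^-1 * ((if (0 < m < K)%N then e%:R else 0)
   - (if (0 < m)%N then (e * m - 1)%:R / m%:R else 0)).
exists mu => g H g0 H0 i iD.
have := residue_log_derivative e0 g0 H0 hK iD.
set phi := 'X^e - _ => E.
pose c m := (phi ^+ m)`_(e * m - 1)`_i.
(* Since [P' = e w^(e-1) - phi'] and [phi' phi^m = (phi^(m+1))' / (m+1)], each summand involves only
   [c m] and [c m.+1]. *)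
have step (m : nat) : (m < K)%N ->
   ((('X - g%:P) ^+ e * H)^`() * (phi ^+ m * 'X^(e * (K.-1 - m))))`_(e * K - 2)`_i
   = (if (0 < m)%N then e%:R else 0) *: c m
     - ((e * m.+1 - 1)%:R / m.+1%:R) *: c m.+1.
  move=> mK; apply: (scalerI (nz m)); rewrite scalerBr !scalerA.
  have -> : ('X - g%:P) ^+ e * H = 'X^e - phi by rewrite /phi; ring.
  rewrite [m.+1%:R * (_ / _)]mulrC divfK //.
  have -> : ('X^e - phi)^`() * (phi ^+ m * 'X^(e * (K.-1 - m)))
     = 'X^(e * (K.-1 - m)) * ('X^(e.-1) * phi ^+ m *+ e - phi^`() * phi ^+ m).
    by rewrite derivB derivXn; ring.
  rewrite !coefXnMpoly scaler_nat scaler_nat.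
  (* The exponent read lies below that of the factor [w^(e (K-1-m))] only for [m = 0] and [e = 1];
     there [e * m.+1 - 1 = 0], so the other side vanishes too. *)
  case: ltnP => h1.
    have [-> ->] : m = 0%N /\ e = 1%N by nia.
    by rewrite mul0rn /= mulr0 scale0r subr0.
  have h2 : (1 < e * m.+1)%N by nia.
  have -> : (e * K - 2 - e * (K.-1 - m) = e * m.+1 - 2)%N by nia.
  rewrite !coefB mulrnBl; congr (_ - _); last first.
    rewrite -!coefMn.
    have -> : phi^`() * phi ^+ m *+ m.+1 = (phi ^+ m.+1)^`().
      by rewrite deriv_exp.
    rewrite coef_deriv coefMn /c.
    by have -> : (e * m.+1 - 2).+1 = (e * m.+1 - 1)%N by lia.
  rewrite !coefMn !coefXnMpoly /c; case: m mK h1 h2 => [|m] mK h1 h2 /=.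
    by rewrite ifT ?mul0rn ?mulr0 ?scale0r //; lia.
  rewrite ifN; last by rewrite !mulnS; lia.
  rewrite -mulrnA -natrM scaler_nat.
  have -> : (e * m.+2 - 2 - e.-1 = e * m.+1 - 1)%N.
    by rewrite mulnS; lia.
  by rewrite (mulnC m.+2).
apply: (@scalerI _ _ (e%:R : F)).
  by case: (e) e0 => // e' _; apply: nz.
rewrite scaler_nat {}E mulr_sumr coef_sum coef_sum scaler_sumr.
rewrite (eq_bigr _ (fun m _ => step _ (ltn_ord m))) sumrB.
have e'0 : e%:R != 0 :> F by case: (e) e0 => // e' _; apply: nz.
under [RHS]eq_bigr => m _ do rewrite scalerA /mu mulrA divff // mul1r scalerBl.
rewrite sumrB; congr (_ - _).
  rewrite big_ord_recr /= ltnn andbF scale0r addr0.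
  by apply: eq_bigr => -[m /= mK] _; rewrite mK andbT.
by rewrite [RHS]big_ord_recl /= scale0r add0r; apply: eq_bigr.
Qed.

End Inversion.

(** * Roots of polynomials with small branching programs *)

Lemma rmorph_mmap (n : nat) (F S S' : comNzRingType) (f : {rmorphism F -> S})
    (f' : {rmorphism F -> S'}) (g : {rmorphism S -> S'})
    (h : 'I_n -> S) (h' : 'I_n -> S') (p : {mpoly F[n]}) :
  (forall c, g (f c) = f' c) -> (forall i, g (h i) = h' i) ->
  g (mmap f h p) = mmap f' h' p.
Proof.
move=> hc hh; rewrite /mmap rmorph_sum; apply: eq_bigr => m _.
rewrite rmorphM hc /mmap1 rmorph_prod; congr (_ * _).
by apply: eq_bigr => i _; rewrite rmorphXn hh.
Qed.

Definition last_poly (F : comNzRingType) (n : nat) (p : {mpoly F[n.+1]}) :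
    {poly {mpoly F[n]}} :=
  mmap (polyC \o @mpolyC n F)
    (fun i => oapp (fun j => ('X_j)%:P) 'X (unlift ord_max i)) p.

Definition ext (T : Type) (n : nat) (x : 'I_n -> T) (y : T) (i : 'I_n.+1) : T :=
  oapp x y (unlift ord_max i).

(** Substituting the last variable back for the univariate one is a left inverse. *)
Lemma last_poly_eq0 (F : comNzRingType) (n : nat) (p : {mpoly F[n.+1]}) :
  last_poly p = 0 -> p = 0.
Proof.
move=> h.
pose B : {rmorphism {mpoly F[n]} -> {mpoly F[n.+1]}} :=
  comp_mpoly [tuple 'X_(lift ord_max i) | i < n].
have <- : horner_eval 'X_ord_max (map_poly B (last_poly p)) = p.
  pose G : {rmorphism {poly {mpoly F[n]}} -> {mpoly F[n.+1]}} :=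
    horner_eval 'X_ord_max \o map_poly B.
  rewrite -[LHS]/(G _) /last_poly (@rmorph_mmap _ _ _ _ _ (@mpolyC n.+1 F) G _ (fun i => 'X_i)).
  - rewrite -[RHS]comp_mpoly_id /comp_mpoly; apply: eq_bigr => m _; congr (_ * _).
    by apply: mmap1_eq => i; rewrite tnth_mktuple.
  - by move=> c; rewrite /= /horner_eval map_polyC /= hornerC /B /= comp_mpolyC.
  - move=> i; case: unliftP => [j ->|->] /=; rewrite /horner_eval.
      by rewrite map_polyC /= hornerC comp_mpolyXU -tnth_nth tnth_mktuple.
    by rewrite map_polyX hornerX.
by rewrite h map_poly0 /horner_eval horner0.
Qed.

Lemma last_polyE (F : comNzRingType) (n : nat) (p : {mpoly F[n.+1]}) x y :
  (map_poly (meval x) (last_poly p)).[y] = p.@[ext x y].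
Proof.
pose G : {rmorphism {poly {mpoly F[n]}} -> F} :=
  horner_eval y \o map_poly (meval x).
rewrite -[LHS]/(G _) /last_poly (@rmorph_mmap _ _ _ _ _ idfun G _ (ext x y)) //.
- by move=> c; rewrite /= /horner_eval map_polyC /= hornerC mevalC.
- move=> i; rewrite /ext; case: unliftP => [j _|_] /=; rewrite /horner_eval.
    by rewrite map_polyC /= hornerC mevalXU.
  by rewrite map_polyX hornerX.
Qed.

(** * Nonvanishing points and interpolation in characteristic zero *)

Section CharZero.
Variable F : fieldType.
Hypothesis F0 : [pchar F] =i pred0.

Lemma natr_inj : injective (fun i : nat => i%:R : F).
Proof.
move=> i j /= h; wlog ij : i j h / (i <= j)%N.
  by move=> hw; case: (leqP i j) => [|/ltnW] ij; [|symmetry]; apply: hw.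
apply/eqP; rewrite eqn_leq ij /= -subn_eq0 -((pcharf0P F).1 F0) natrB // h.
by rewrite subrr.
Qed.

Lemma poly_neq0_eval (p : {poly F}) : p != 0 -> exists a, p.[a] != 0.
Proof.
move=> p0; pose s := [seq (i%:R : F) | i <- iota 0 (size p)].
have us : uniq s by rewrite map_inj_uniq ?iota_uniq //; exact: natr_inj.
have [/(max_poly_roots p0)/(_ us)|/allPn[a _ ha]] := boolP (all (root p) s).
  by rewrite size_map size_iota ltnn.
by exists a.
Qed.

(** Induction on the number of variables: first a point where the leading coefficient in the last
    variable survives, then a value of that variable. *)
Lemma mpoly_neq0_eval n (p : {mpoly F[n]}) : p != 0 -> exists v, p.@[v] != 0.
Proof.
elim: n p => [|n IH] p p0.
  exists (fun _ => 0).
  have : (msize p <= 1)%N.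
    rewrite msizeE; apply/bigmax_leqP_seq => m _ _.
    by rewrite mdegE big_ord0.
  by move/msize1_polyC => E; move: p0; rewrite E mpolyC_eq0 mevalC.
have lp0 : last_poly p != 0 by apply: contra_neq p0; apply: last_poly_eq0.
have /IH[x hx] : lead_coef (last_poly p) != 0 by rewrite lead_coef_eq0.
have /poly_neq0_eval[y hy] : map_poly (meval x) (last_poly p) != 0.
  apply: contraNneq hx => h.
  by rewrite lead_coefE -(coef_map (meval x)) h coef0.
by exists (ext x y); rewrite -last_polyE.
Qed.

(** The Vandermonde matrix at the nodes [0, ..., M - 1] is invertible in characteristic zero. The
    weights lie in [F] although [r] has coefficients in [A], so interpolation costs only scalings
    and sums. *)
Lemma interpolation (A : comNzRingType) (iota : {rmorphism F -> A}) (M j : nat) :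
  exists lam : nat -> F, forall r : {poly A}, (size r <= M)%N ->
    r`_j = \sum_(a < M) iota (lam a) * r.[a%:R].
Proof.
case: (ltnP j M) => [jM|Mj]; last first.
  exists (fun _ => 0) => r hr; rewrite nth_default ?(leq_trans hr) // big1 // => a _.
  by rewrite rmorph0 mul0r.
pose V : 'M[F]_M := Vandermonde M (\row_a (a : nat)%:R).
have uV : V \in unitmx.
  rewrite unitmxE unitfE det_Vandermonde; apply/prodf_neq0 => i _.
  apply/prodf_neq0 => k ik; rewrite !mxE subr_eq0; apply/eqP => /natr_inj h.
  by rewrite h ltnn in ik.
pose l : 'cV_M := invmx V *m delta_mx (Ordinal jM) 0.
have Vl (i : 'I_M) : \sum_(a < M) (a : nat)%:R ^+ i * l a 0 = (i == j :> nat)%:R.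
  have := congr1 (fun B : 'cV_M => B i 0) (mulKVmx uV (delta_mx (Ordinal jM) 0)).
  rewrite mxE [in RHS]mxE andbT => <-.
  by apply: eq_bigr => a _; rewrite !mxE.
exists (fun a => if insub a is Some a' then l a' 0 else 0) => r hr.
under eq_bigr => a _ do rewrite valK (horner_coef_wide _ hr) mulr_sumr.
rewrite exchange_big /= (bigD1 (Ordinal jM)) //= [X in _ + X]big1 => [|i ij].
  have := congr1 iota (Vl (Ordinal jM)); rewrite eqxx rmorph1 rmorph_sum => E.
  rewrite addr0; transitivity (r`_j * \sum_(a < M) iota ((a : nat)%:R ^+ j * l a 0)).
    by rewrite E mulr1.
  rewrite mulr_sumr; apply: eq_bigr => a _.
  rewrite rmorphM rmorphXn rmorph_nat [iota _ * (_ * _)]mulrCA; congr (_ * _).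
  by rewrite mulrC.
have := congr1 iota (Vl i); rewrite (negbTE (ij : i != j :> nat)) rmorph0 rmorph_sum => E.
transitivity (r`_i * \sum_(a < M) iota ((a : nat)%:R ^+ i * l a 0)); last first.
  by rewrite E mulr0.
rewrite mulr_sumr; apply: eq_bigr => a _.
rewrite rmorphM rmorphXn rmorph_nat [iota _ * (_ * _)]mulrCA; congr (_ * _).
by rewrite mulrC.
Qed.

End CharZero.

(** If [g] had degree above [D], the top term of [p.[g]] would exceed all others in degree and could
    not cancel. *)
Lemma size_root_le (A : idomainType) (p : {poly {poly A}}) (g : {poly A}) (D : nat) :
  p != 0 -> p.[g] = 0 -> (forall i, (size (p`_i)%R <= D.+1)%N) -> (size g <= D.+1)%N.
Proof.
move=> p0 pg hp; rewrite leqNgt; apply/negP => hg.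
have g0 : g != 0 by rewrite -size_poly_gt0; lia.
have sp : (0 < size p)%N by rewrite size_poly_gt0.
move: pg; rewrite horner_coef -(prednK sp) big_ord_recr /=.
set m := (size p).-1; move/eqP; rewrite addr_eq0 => /eqP E.
have lc0 : p`_m != 0 by rewrite -/(lead_coef p) lead_coef_eq0.
have lcs : (0 < size (p`_m)%R)%N by rewrite size_poly_gt0.
have sX k : size (g ^+ k) = (k * (size g).-1).+1.
  by rewrite -[LHS]prednK ?size_poly_gt0 ?expf_neq0 // size_exp mulnC.
have := size_mul lc0 (expf_neq0 m g0); rewrite -size_polyN -E sX.
have [/eqP m0|m0] := boolP (m == 0%N).
  by move: lcs; rewrite m0 big_ord0 size_poly0 mul0n; lia.
have : (size (\sum_(i < m) p`_i * g ^+ i)%R <= D.+1 + m.-1 * (size g).-1)%N.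
  apply: leq_trans (size_sum _ _ _) _; apply/bigmax_leqP => -[i /= im] _.
  apply: leq_trans (size_polyMleq _ _) _; rewrite sX addnS /=.
  by apply: leq_add => //; rewrite leq_mul2r; apply/orP; right; lia.
have -> : (m * (size g).-1 = (size g).-1 + m.-1 * (size g).-1)%N.
  by case: (m) m0 => // m' _; rewrite mulSn.
by move=> h1 h2; rewrite h2 in h1; lia.
Qed.

Section Bidegree.
Variable A : comNzRingType.
Implicit Types (r u : {poly {poly A}}).

Definition bideg_le (d : nat) r : Prop :=
  (size r <= d.+1)%N /\ forall i, (size (r`_i)%R <= d.+1)%N.

Lemma bideg_le_mono d d' r : (d <= d')%N -> bideg_le d r -> bideg_le d' r.
Proof.
move=> h [h1 h2]; split=> [|i]; first exact: leq_trans h1 _.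
exact: leq_trans (h2 i) _.
Qed.

Lemma bideg_leD d r u : bideg_le d r -> bideg_le d u -> bideg_le d (r + u).
Proof.
move=> [h1 h2] [h3 h4]; split=> [|i].
  by apply: leq_trans (size_polyD _ _) _; rewrite geq_max h1.
by rewrite coefD; apply: leq_trans (size_polyD _ _) _; rewrite geq_max h2 h4.
Qed.

Lemma bideg_leN d r : bideg_le d r -> bideg_le d (- r).
Proof. by move=> [h1 h2]; split=> [|i]; rewrite ?coefN size_polyN. Qed.

Lemma bideg_leM d d' r u : bideg_le d r -> bideg_le d' u -> bideg_le (d + d') (r * u).
Proof.
move=> [h1 h2] [h3 h4]; split=> [|i].
  apply: leq_trans (size_polyMleq _ _) _; lia.
rewrite coefM; apply: leq_trans (size_sum _ _ _) _; apply/bigmax_leqP => j _.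
apply: leq_trans (size_polyMleq _ _) _; move: (h2 j) (h4 (i - j)%N); lia.
Qed.

Lemma bideg_leX d r m : bideg_le d r -> bideg_le (m * d) (r ^+ m).
Proof.
move=> h; elim: m => [|m IH]; last by rewrite exprS mulSn; apply: bideg_leM.
split=> [|i]; rewrite expr0 ?size_poly1 ?coef1 //.
by case: eqP => _; rewrite ?size_poly1 ?size_poly0.
Qed.

Lemma bideg_leC (s : {poly A}) d : (size s <= d.+1)%N -> bideg_le d s%:P.
Proof.
move=> h; split=> [|i]; last by rewrite coefC; case: eqP; rewrite ?size_poly0.
by apply: leq_trans (size_polyC_leq1 _) _.
Qed.

Lemma bideg_le_X : bideg_le 1 'X.
Proof.
split=> [|i]; first by rewrite size_polyX.
by rewrite coefX; case: eqP => _; rewrite ?size_poly1 ?size_poly0.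
Qed.

Lemma bideg_le_mmap (F : comNzRingType) n (iota : {rmorphism F -> A})
    (h : 'I_n -> {poly {poly A}}) (D : nat) (p : {mpoly F[n]}) :
  (forall i, bideg_le 1 (h i)) -> (msize p <= D.+1)%N ->
  bideg_le D (mmap (polyC \o polyC \o iota) h p).
Proof.
move=> hh hp; rewrite /mmap big_seq.
apply: (big_ind (bideg_le D)) => [|r u|m hm].
- by split=> [|i]; rewrite ?coef0 size_poly0.
- exact: bideg_leD.
rewrite -[D]add0n; apply: bideg_leM.
  by apply: bideg_leC; rewrite /= size_polyC_leq1.
apply: (@bideg_le_mono (mdeg m)).
  by rewrite -ltnS; apply: leq_trans (msize_mdeg_lt hm) hp.
rewrite mdegE /mmap1; apply: (big_rec2 (fun d r => bideg_le d r)) => [|i d r _ hr].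
  by apply: bideg_leC; rewrite size_poly1.
by apply: bideg_leM => //; have := bideg_leX (m i) (hh i); rewrite muln1.
Qed.

End Bidegree.

Lemma size_horner_nat (A : comNzRingType) d (r : {poly {poly A}}) (b : nat) :
  bideg_le d r -> (size r.[b%:R]%R <= d.+1)%N.
Proof.
move=> [_ h]; rewrite horner_coef; apply: leq_trans (size_sum _ _ _) _.
apply/bigmax_leqP => k _; rewrite -natrX -polyC_natr mulrC mul_polyC.
exact: leq_trans (size_scale_leq _ _) (h k).
Qed.

Lemma XsubC_exp_mul (B : idomainType) (g : B) (H : {poly B}) (e : nat) :
  let P := ('X - g%:P) ^+ e * H in
  H != 0 -> (0 < e)%N -> [/\ P != 0, (e < size P)%N & P.[g] = 0].
Proof.
move=> P H0 e0; split.
- by rewrite mulf_neq0 // expf_neq0 // polyXsubC_eq0.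
- rewrite /P mulrC size_Mmonic ?monic_exp ?monicXsubC // size_exp_XsubC.
  by rewrite addnS /= -[X in (X < _)%N]add0n ltn_add2r size_poly_gt0.
- by rewrite hornerM horner_exp hornerXsubC subrr expr0n gtn_eqF // mul0r.
Qed.

(** * Expanding a root in affine instances of its equation *)

Section RootIMM.
Variable F : fieldType.
Hypothesis F0 : [pchar F] =i pred0.
Variables (N nu : nat) (Q : {mpoly F[N.+1]}) (Phi : {mpoly F[N]}).
Variable sg : N.-tuple {mpoly F[nu]}.
Variables (W L D : nat).
Hypothesis affine_sg : forall i, (msize (tnth sg i) <= 2)%N.
Hypothesis Q0 : Q != 0.
Hypothesis QPhi : forall x, Q.@[ext x (Phi.@[x])] = 0.
Hypothesis immQ : imm W L Q.
Hypothesis degQ : (msize Q <= D.+1)%N.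

Local Notation A := {mpoly F[nu]}.
Local Notation K := (D.+2 * D.+2)%N.
Local Notation M := ((K * D).+1).

Let iot : {rmorphism F -> A} := @mpolyC nu F.

(** Restriction to the line from the constant point [al] at [tau = 0] to the target [sg] at
    [tau = 1]. *)
Let rho (al : 'I_N -> F) : {rmorphism {mpoly F[N]} -> {poly A}} :=
  mmap (polyC \o iot) (fun i => ((al i)%:MP)%:P + (tnth sg i - (al i)%:MP)%:P * 'X).

Let pull (al : 'I_N -> F) (y : F) (a b : F) : N.+1.-tuple A :=
  [tuple ext (fun i => (al i)%:MP + (tnth sg i - (al i)%:MP) * a%:MP)
          ((b + y)%:MP) i | i < N.+1].

Lemma pull_affine al y a b i : (msize (tnth (pull al y a b) i) <= 2)%N.
Proof.
rewrite tnth_mktuple /ext; case: unliftP => [j _|_] /=; last exact: msizeC_le2.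
apply: leq_trans (msizeD_le _ _) _; rewrite geq_max msizeC_le2 /=.
rewrite mulrC mul_mpolyC; apply: leq_trans (msizeZ_le _ _) _.
apply: leq_trans (msizeD_le _ _) _; rewrite geq_max affine_sg /=.
by rewrite msizeN msizeC_le2.
Qed.

(** The width counts the value at the base point, the [D.+1] coefficients of the root, the powers of
    [phi], two interpolations with [M] nodes, and [Q] plus a constant. The length is that of a
    [K]-th power. *)
Lemma imm_root :
  imm (1 + D.+1 * (K.+1 * (M * (M * (W + 1))))) (K * L.+1) (Phi \mPo sg).
Proof.
set Qt := last_poly Q.
have Qt0 : Qt != 0 by apply: contra_neq Q0; apply: last_poly_eq0.
(* A polynomial that vanishes at all points is zero in characteristic zero. *)
have rQt : root Qt Phi.
  apply/eqP; apply/eqP; apply/negPn/negP => /(mpoly_neq0_eval F0)[x].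
  by rewrite -horner_map last_polyE QPhi eqxx.
have [e [Ht]] := multiplicity_XsubC Qt Phi.
rewrite Qt0 /= => rHt EQt.
have e0 : (0 < e)%N.
  by case: e EQt => //; rewrite expr0 mulr1 => EQt; move: rHt; rewrite -EQt rQt.
(* Starting the line where the cofactor does not vanish makes the constant coefficient of the
   cofactor a nonzero scalar [c]. *)
have /(mpoly_neq0_eval F0)[al hal] : Ht.[Phi] != 0 by [].
set y := Phi.@[al].
pose c := (map_poly (meval al) Ht).[y].
have c0 : c != 0 by rewrite /c horner_map.
pose g := rho al Phi - (y%:MP)%:P.
have rho0 p : (rho al p).[0] = (p.@[al])%:MP.
  transitivity (mmap iot (fun i => (al i)%:MP) p).
    apply: (@rmorph_mmap _ _ _ _ _ iot (horner_eval 0)) => [c'|i].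
      by rewrite /= /horner_eval hornerC.
    by rewrite /= /horner_eval hornerD hornerM hornerX !hornerC mulr0 addr0.
  by symmetry; apply: (@rmorph_mmap _ _ _ _ idfun iot iot).
(* Restriction to the line composed with the shift [w -> w + y], under which the root [Phi] becomes
   [g]. *)
pose G : {rmorphism {poly {mpoly F[N]}} -> {poly {poly A}}} :=
  comp_poly ('X + (y%:MP)%:P%:P) \o map_poly (rho al).
pose hq : 'I_N.+1 -> {poly {poly A}} :=
  ext (fun i => (((al i)%:MP)%:P + (tnth sg i - (al i)%:MP)%:P * 'X)%:P) ('X + (y%:MP)%:P%:P).
pose q := mmap (polyC \o polyC \o iot) hq Q.
have Eq : q = ('X - g%:P) ^+ e * G Ht.
  have -> : q = G Qt.
    symmetry; apply: rmorph_mmap => [c'|i].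
      by rewrite /= map_polyC /= comp_polyC /rho /= mmapC.
    rewrite /hq /ext; case: unliftP => [j _|_] /=.
      by rewrite map_polyC /= comp_polyC /rho /= mmapX mmap1U.
    by rewrite map_polyX comp_polyX.
  rewrite EQt rmorphM rmorphXn mulrC; congr (_ ^+ _ * _).
  rewrite rmorphB /= map_polyX map_polyC comp_polyX comp_polyC /= /g rmorphB /=.
  by rewrite opprB addrA.
have GHt : (G Ht)`_0`_0 = c%:MP.
  rewrite -2!horner_coef0 /G /= horner_comp hornerD hornerX hornerC add0r.
  rewrite -[LHS]/(horner_eval 0 _) -horner_map -map_poly_comp /c.
  rewrite -[RHS](horner_map iot) -map_poly_comp.
  congr (_.[_]); first by apply: eq_map_poly => p; apply: rho0.
  by rewrite /= /horner_eval hornerC.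
have GH0 : G Ht != 0.
  apply: contra_neq c0 => h; move: GHt; rewrite h !coef0 => /esym/eqP.
  by rewrite mpolyC_eq0 => /eqP.
have [q0 qe qg] := XsubC_exp_mul g GH0 e0.
rewrite -Eq in q0 qe qg.
have bq : bideg_le D q.
  apply: bideg_le_mmap degQ => i; rewrite /hq /ext.
  case: unliftP => [j _|_] /=.
    apply: bideg_leC; apply: leq_trans (size_polyD _ _) _.
    rewrite geq_max (leq_trans (size_polyC_leq1 _)) //=.
    apply: leq_trans (size_polyMleq _ _) _; rewrite size_polyX addn2 ltnS.
    exact: size_polyC_leq1.
  apply: bideg_leD; first exact: bideg_le_X.
  by apply: bideg_leC; apply: leq_trans (size_polyC_leq1 _) _.
have eD : (e <= D)%N by rewrite -ltnS; apply: leq_trans qe bq.1.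
have sg1 : (size g <= D.+1)%N by exact: size_root_le q0 qg bq.2.
pose Hn := ((c^-1)%:MP)%:P%:P * G Ht.
have Hn0 : Hn`_0`_0 = 1.
  by rewrite /Hn !coefCM GHt -mpolyCM mulVf // mpolyC1.
have g0 : g`_0 = 0.
  by rewrite -horner_coef0 /g hornerD hornerN rho0 hornerC subrr.
have hK : (e.+2 * D.+2 <= K)%N by rewrite leq_mul2r; apply/orP; right; lia.
have [mu Emu] := root_as_coefs A F0 e0 hK.
have {Emu} := Emu g Hn g0 Hn0; set phi := 'X^e - _ => Emu.
have Ephi : phi = 'X^e - ((c^-1)%:MP)%:P%:P * q by rewrite /phi Eq mulrCA.
have bphi : bideg_le D phi.
  rewrite Ephi; apply: bideg_leD.
    by apply: (@bideg_le_mono _ (e * 1)); [rewrite muln1|apply: bideg_leX; exact: bideg_le_X].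
  apply: bideg_leN; rewrite -[D]add0n; apply: bideg_leM => //.
  by apply: bideg_leC; apply: size_polyC_leq1.
(* The target is the value at [tau = 1], so the coefficients of [g] are simply added up. *)
have -> : Phi \mPo sg = y%:MP + \sum_(i < D.+1) g`_i.
  have -> : Phi \mPo sg = (rho al Phi).[1].
    symmetry; apply: (@rmorph_mmap _ _ _ _ _ iot (horner_eval 1)) => [c'|i].
      by rewrite /= /horner_eval hornerC.
    by rewrite /= /horner_eval hornerD hornerM hornerX !hornerC mulr1 addrC subrK.
  have -> : rho al Phi = (y%:MP)%:P + g by rewrite /g addrC subrK.
  rewrite hornerD hornerC (horner_coef_wide _ sg1); congr (_ + _).
  by apply: eq_bigr => i _; rewrite expr1n mulr1.
apply: imm_add; first exact: imm_const.
apply: imm_sum => i; rewrite Emu; last by rewrite -ltnS.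
apply: imm_sum => m; apply: imm_scale.
(* Coefficients in [w] and then in [tau] become scalar combinations of values of [phi ^+ m] at pairs
   of integers. *)
have [l El] := interpolation F0 [the {rmorphism F -> {poly A}} of polyC \o iot] M (e * m - 1).
have [l' El'] := interpolation F0 iot M i.
have bphim : bideg_le (K * D) (phi ^+ m).
  by apply: bideg_le_mono (bideg_leX m bphi); rewrite leq_mul2r -[(m <= _)%N]ltnS ltn_ord orbT.
rewrite El; last exact: bphim.1.
rewrite coef_sum; apply: imm_sum => b.
rewrite /= coefCM mul_mpolyC; apply: imm_scale.
rewrite El'; last exact: size_horner_nat.
apply: imm_sum => a; rewrite mul_mpolyC; apply: imm_scale.
rewrite !horner_exp addn1; apply: (@imm_mono _ _ W.+1 _ (m * L.+1)) => //.
  by rewrite leq_mul2r -[(m <= _)%N]ltnS ltn_ord orbT.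
apply: imm_exp.
have -> : phi.[b%:R].[a%:R] =
    (b%:R ^+ e)%:MP + (- c^-1) *: (Q \mPo pull al y a%:R b%:R).
  rewrite Ephi hornerD hornerN hornerXn hornerM hornerC -natrX -polyC_natr.
  rewrite hornerD hornerN hornerM !hornerC -natrX mpolyC_nat.
  rewrite scaleNr -mul_mpolyC; congr (_ - _ * _).
  pose G' : {rmorphism {poly {poly A}} -> A} := horner_eval a%:R \o horner_eval b%:R.
  apply: (@rmorph_mmap _ _ _ _ (polyC \o polyC \o iot) iot G') => [c'|j].
    by rewrite /= /horner_eval !hornerC.
  rewrite tnth_mktuple /hq /ext /= /horner_eval; case: unliftP => [k _|_] /=.
    by rewrite hornerC hornerD hornerM hornerX !hornerC mpolyC_nat.
  by rewrite hornerD hornerX hornerC -polyC_natr hornerD !hornerC mpolyCD mpolyC_nat.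
rewrite addrC -addn1; apply: imm_add; last exact: imm_const.
by apply: imm_scale; apply: imm_comp => //; exact: pull_affine.
Qed.

End RootIMM.

(** * Perturbed circuits and the generator *)

Section PerturbedCircuit.
Variables (F : fieldType) (m : nat).
Implicit Types (a b : operand F m) (g : gate_op * operand F m * operand F m).

Definition slot_val (R : comNzRingType) (vals : nat -> R) (x : R) a : R :=
  if a is InternalGate j then vals j else x.

Definition gate_val (R : comNzRingType) (vals : nat -> R) g (x y : R) : R :=
  let: (op, a, b) := g in
  match op with
  | PlusGate => slot_val vals x a + slot_val vals y b
  | TimesGate => slot_val vals x a * slot_val vals y b
  end.

(* Gate [i] reads its non-internal operands from [u (3 i)] and [u (3 i + 1)]
   and its value is shifted by [u (3 i + 2)]. *)
Definition run (R : comNzRingType) (u : nat -> R)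
    (gs : seq (gate_op * operand F m * operand F m)) : seq R :=
  foldl (fun vals g => let i := size vals in
    rcons vals (gate_val (nth 0 vals) g (u (3 * i)%N) (u (3 * i).+1)
                + u (3 * i).+2)) [::] gs.

Variables (gs : seq (gate_op * operand F m * operand F m)) (out : operand F m).
Let s := size gs.
Let g0 := (PlusGate, out, out).
Local Notation gt i := (nth g0 gs i).

Definition run_out (R : comNzRingType) (u : nat -> R) : R :=
  slot_val (nth 0 (run u gs)) (u (3 * s)%N) out.

Lemma run_rcons (R : comNzRingType) (u : nat -> R) gs' g :
  run u (rcons gs' g) = rcons (run u gs')
    (gate_val (nth 0 (run u gs')) g (u (3 * size (run u gs'))%N)
       (u (3 * size (run u gs')).+1) + u (3 * size (run u gs')).+2).
Proof. by rewrite /run -cats1 foldl_cat. Qed.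

Lemma size_run (R : comNzRingType) (u : nat -> R) gs' : size (run u gs') = size gs'.
Proof. by elim/last_ind: gs' => // gs' g IH; rewrite run_rcons !size_rcons IH. Qed.

Lemma run_morph (R R' : comNzRingType) (f : {rmorphism R -> R'}) (u : nat -> R) gs' :
  map f (run u gs') = run (f \o u) gs'.
Proof.
elim/last_ind: gs' => // gs' g IH; rewrite !run_rcons map_rcons -IH size_map.
congr rcons; rewrite rmorphD; congr (_ + _).
have E x a : f (slot_val (nth 0 (run u gs')) x a)
    = slot_val (nth 0 (map f (run u gs'))) (f x) a.
  case: a => //= j; case: (ltnP j (size (run u gs'))) => h.
    by rewrite (nth_map 0).
  by rewrite !nth_default ?size_map ?rmorph0.
by case: g => [[[] a] b] /=; rewrite ?rmorphD ?rmorphM !E.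
Qed.

Lemma run_out_morph (R R' : comNzRingType) (f : {rmorphism R -> R'}) (u : nat -> R) :
  f (run_out u) = run_out (f \o u).
Proof.
rewrite /run_out -run_morph; case: out => //= j.
case: (ltnP j (size (run u gs))) => h; first by rewrite (nth_map 0).
by rewrite !nth_default ?size_map ?rmorph0.
Qed.

Lemma run_out_ext (R : comNzRingType) (u u' : nat -> R) :
  (forall k, (k < (3 * s).+1)%N -> u k = u' k) -> run_out u = run_out u'.
Proof.
move=> h; have E : run u gs = run u' gs.
  move: h; rewrite /s; elim/last_ind: gs => // gs' g IH h; rewrite !run_rcons.
  rewrite IH => [|k hk]; last by apply: h; rewrite size_rcons; lia.
  by rewrite !h // size_rcons size_run; lia.
by rewrite /run_out E h.
Qed.

Hypothesis acyclic : forall i, (i < s)%N ->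
  let: (_, a, b) := gt i in operand_below i a && operand_below i b.

(** By acyclicity later gates do not affect earlier ones, so the complete list of values satisfies
    all gate equations at once. *)
Lemma run_nth (R : comNzRingType) (u : nat -> R) i : (i < s)%N ->
  (run u gs)`_i = gate_val (nth 0 (run u gs)) (gt i) (u (3 * i)%N) (u (3 * i).+1)
    + u (3 * i).+2.
Proof.
move: acyclic; rewrite /s; elim/last_ind: gs i => // gs' g IH i ac.
rewrite size_rcons ltnS => hi.
have SE (vals : seq R) x y a : operand_below (size vals) a ->
    slot_val (nth 0 (rcons vals x)) y a = slot_val (nth 0 vals) y a.
  by case: a => //= j hj; rewrite nth_rcons hj.
have GE (vals : seq R) x y z k h : (k <= size vals)%N ->
    (let: (_, a, b) := h in operand_below k a && operand_below k b) ->
    gate_val (nth 0 (rcons vals x)) h y z = gate_val (nth 0 vals) h y z.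
  have le a : (k <= size vals)%N -> operand_below k a -> operand_below (size vals) a.
    by case: a => //= j h1 h2; apply: leq_trans h2 h1.
  by case: h => [[[] a] b] kv /andP[/(le _ kv) ha /(le _ kv) hb] /=; rewrite !SE.
have := ac i; rewrite size_rcons ltnS hi => /(_ isT) aci.
rewrite run_rcons nth_rcons size_run; case: ltnP => h.
  have h' := h; rewrite nth_rcons h in aci *.
  rewrite (GE _ _ _ _ i) ?size_run ?(ltnW h) //.
  rewrite [LHS]nth_rcons size_run h'; apply: IH => // k hk.
  by have := ac k; rewrite size_rcons nth_rcons hk ltnS (ltnW hk) => /(_ isT).
have ei : i = size gs' by lia.
rewrite ei nth_rcons ltnn eqxx in aci; rewrite ei eqxx.
rewrite (GE _ _ _ _ (size gs')) ?size_run //.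
by rewrite [LHS]nth_rcons size_run ltnn eqxx.
Qed.

Hypothesis valid : operand_below s out.

(* [y (3 i + 2)] stands for the value of gate [i]. *)
Definition block_coord (R : comNzRingType) (y : nat -> R) (o : nat) : R :=
  let vals j := y (3 * j).+2 in
  if o == (3 * s).+1 then slot_val vals (y (3 * s)%N) out
  else if (o %% 3 == 2)%N then
    y o - gate_val vals (gt (o %/ 3)) (y (o - 2)%N) (y (o - 1)%N)
  else y o.

Lemma block_coord_morph (R R' : comNzRingType) (f : {rmorphism R -> R'}) (y : nat -> R) o :
  f (block_coord y o) = block_coord (f \o y) o.
Proof.
have E vals x a : f (slot_val vals x a) = slot_val (f \o vals) (f x) a.
  by case: a.
rewrite /block_coord; case: ifP => _; first by rewrite E.
case: ifP => // _; rewrite rmorphB; congr (_ - _).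
by case: (gt _) => [[[] a] b] /=; rewrite ?rmorphD ?rmorphM !E.
Qed.

Lemma block_coord_ext (R : comNzRingType) (y y' : nat -> R) o :
  (o < (3 * s).+2)%N -> (forall k, (k < (3 * s).+1)%N -> y k = y' k) ->
  block_coord y o = block_coord y' o.
Proof.
move=> ho h; rewrite /block_coord.
have E a x : operand_below s a -> slot_val (fun j => y (3 * j).+2) x a
    = slot_val (fun j => y' (3 * j).+2) x a.
  by case: a => //= j hj; rewrite h //; lia.
case: eqP => [_|no]; first by rewrite h // E.
have oN : (o < (3 * s).+1)%N by lia.
rewrite !h //; try lia.
case: eqP => // o2; congr (_ - _).
have os : (o %/ 3 < s)%N by lia.
have le a : operand_below (o %/ 3) a -> operand_below s a.
  by case: a => //= j h1; apply: leq_trans h1 (ltnW os).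
have := acyclic os; case: (gt _) => [[[] a] b] /andP[/le ha /le hb] /=;
  by rewrite !E.
Qed.

(** The preimage of a point [v] of the graph: each shift is traded for the value of its gate. *)
Definition block_seed (R : comNzRingType) (v : nat -> R) (o : nat) : R :=
  if (o %% 3 == 2)%N then (run v gs)`_(o %/ 3) else v o.

(** Subtracting the unshifted gate from the gate value leaves the shift, by [run_nth]. *)
Lemma block_solve (R : comNzRingType) (v : nat -> R) o :
  (o < (3 * s).+2)%N -> v (3 * s).+1 = run_out v ->
  block_coord (block_seed v) o = v o.
Proof.
move=> ho hv; rewrite /block_coord.
have E a x : slot_val (fun j => block_seed v (3 * j).+2) x a
    = slot_val (nth 0 (run v gs)) x a.
  case: a => //= j; rewrite /block_seed.
  have -> : ((3 * j).+2 %% 3 = 2)%N by lia.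
  by have -> : ((3 * j).+2 %/ 3 = j)%N by lia.
have v3 k : (k %% 3 != 2)%N -> block_seed v k = v k.
  by rewrite /block_seed => /negbTE ->.
case: eqP => [->|no]; first by rewrite E v3 ?hv //; lia.
case: eqP => [o2|/eqP no2]; last by rewrite v3.
have os : (o %/ 3 < s)%N by lia.
rewrite [X in X - _]/block_seed o2 /= run_nth // !v3; try lia.
have -> : (3 * (o %/ 3) = o - 2)%N by lia.
have -> : ((o - 2).+1 = o - 1)%N by lia.
have -> : ((o - 1).+1 = o)%N by lia.
by case: (gt _) => [[[] a] b] /=; rewrite !E addrC addKr.
Qed.

(** The substitution that restores the original circuit: slots receive the input labels and shifts
    become [0]. *)
Definition circuit_inputs (k : nat) : {mpoly F[m]} :=
  let: (_, a, b) := gt (k %/ 3) in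
  if (k %% 3 == 0)%N then operand_poly [::] a
  else if (k %% 3 == 1)%N then operand_poly [::] b else 0.

Lemma msize_circuit_inputs k : (msize (circuit_inputs k) <= 2)%N.
Proof.
have E a : (msize (operand_poly [::] a : {mpoly F[m]}) <= 2)%N.
  by case: a => [i|c|j] /=; rewrite ?msizeX ?mdeg1 ?msizeC_le2 // nth_nil msize0.
rewrite /circuit_inputs; case: (gt _) => [[op a] b].
by do 2 case: ifP => _ //; rewrite msize0.
Qed.

Lemma run_circuit : run_out circuit_inputs = operand_poly (gates_polys gs) out.
Proof.
clear acyclic valid.
have SE (vals : seq {mpoly F[m]}) a :
    slot_val (nth 0 vals) (operand_poly [::] a) a = operand_poly vals a.
  by case: a.
have E : run circuit_inputs gs = gates_polys gs.
  have : forall i, (i < size gs)%N ->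
    [/\ circuit_inputs (3 * i)%N = operand_poly [::] (gt i).1.2,
        circuit_inputs (3 * i).+1 = operand_poly [::] (gt i).2 &
        circuit_inputs (3 * i).+2 = 0].
    move=> i _; rewrite /circuit_inputs.
    have -> : (3 * i %/ 3 = i)%N by lia.
    have -> : ((3 * i).+1 %/ 3 = i)%N by lia.
    have -> : ((3 * i).+2 %/ 3 = i)%N by lia.
    have -> : (3 * i %% 3 = 0)%N by lia.
    have -> : ((3 * i).+1 %% 3 = 1)%N by lia.
    have -> : ((3 * i).+2 %% 3 = 2)%N by lia.
    by case: (gt i) => [[op a] b].
  elim/last_ind: gs => // gs' g IH h; rewrite run_rcons IH; last first.
    move=> i hi; have := h i; rewrite size_rcons nth_rcons hi.
    by apply; apply: leqW.
  have -> : gates_polys (rcons gs' g) =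
      rcons (gates_polys gs') (gate_poly (gates_polys gs') g).
    by rewrite /gates_polys -cats1 foldl_cat.
  congr rcons.
  have sg : size (gates_polys gs') = size gs'.
    by rewrite -IH ?size_run // => i hi; have := h i; rewrite size_rcons nth_rcons hi;
      apply; apply: leqW.
  have := h (size gs'); rewrite size_rcons nth_rcons ltnn eqxx ltnSn => /(_ isT) [].
  rewrite sg => -> -> ->; rewrite addr0.
  by case: g {h} => [[[] a] b] /=; rewrite !SE.
rewrite /run_out E -[RHS]SE; congr slot_val.
(* No gate has index [s]; the default gate [g0] carries [out] as operand, so slot [3 s] receives the
   label of the output. *)
rewrite /circuit_inputs; have -> : (3 * s %/ 3 = s)%N by lia.
have -> : (3 * s %% 3 = 0)%N by lia.
by rewrite nth_default.
Qed.

End PerturbedCircuit.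

Section SeedVariables.
Variables (F : fieldType) (l : nat).

Definition var_op (k : nat) : operand F l :=
  if insub k is Some i then VarInput F i else ConstInput l 0.

Definition var (k : nat) : {mpoly F[l]} := operand_poly [::] (var_op k).

Lemma varE (w : nat -> F) k : (k < l)%N -> (var k).@[fun i : 'I_l => w i] = w k.
Proof.
by move=> kl; rewrite /var /var_op insubT /= mevalXU.
Qed.

Lemma msize_var k : (msize (var k) <= 2)%N.
Proof.
rewrite /var /var_op; case: insubP => [i _ _|_] /=.
  by rewrite msizeX mdeg1.
by rewrite mpolyC0 msize0.
Qed.

(** A uniform constant bound that puts every sequence of such polynomials in [VNC0]; [msize] at most
    [3] is degree at most two. *)
Definition local_poly (p : {mpoly F[l]}) : Prop :=
  (msize p <= 3)%N /\ exists2 C : circuit F l, circuit_poly C = p & (circuit_size C <= 3)%N.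

Lemma circuit_of_input (a : operand F l) : operand_below 0 a ->
  exists2 C : circuit F l, circuit_poly C = operand_poly [::] a & (circuit_size C <= 3)%N.
Proof.
move=> val; pose gs : seq (gate_op * operand F l * operand F l) := [::].
have ac : forall (i : nat) g0, (i < size gs)%N ->
    let: (_, a, b) := nth g0 gs i in operand_below i a && operand_below i b by [].
by exists (@Circuit F l gs a ac val).
Qed.

Lemma local_var k : local_poly (var k).
Proof.
split; first exact: leq_trans (msize_var k) _.
by apply: circuit_of_input; rewrite /var_op; case: insub.
Qed.

Lemma local0 : local_poly 0.
Proof.
split; first by rewrite msize0.
by have := @circuit_of_input (ConstInput l (0 : F)) isT; rewrite /= mpolyC0.
Qed.

Lemma local_gate op k k1 k2 :
  local_poly (var k - match op with
    | PlusGate => var k1 + var k2 | TimesGate => var k1 * var k2 end).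
Proof.
split.
  apply: leq_trans (msizeD_le _ _) _; rewrite geq_max msizeN.
  rewrite (leq_trans (msize_var k)) //=; case: op.
    apply: leq_trans (msizeD_le _ _) _.
    by rewrite geq_max (leq_trans (msize_var _)) // (leq_trans (msize_var _)).
  have [->|z1] := eqVneq (var k1) 0; first by rewrite mul0r msize0.
  have [->|z2] := eqVneq (var k2) 0; first by rewrite mulr0 msize0.
  rewrite msizeM //; move: (msize_var k1) (msize_var k2).
  by case: (msize _) => [|[|[]]] //; case: (msize _) => [|[|[]]].
(* The subtraction costs a product with [-1] and a sum. *)
pose gs := [:: (op, var_op k1, var_op k2);
  (TimesGate, ConstInput l (-1), InternalGate F l 0);
  (PlusGate, var_op k, InternalGate F l 1)].
have bel i k' : operand_below i (var_op k') by rewrite /var_op; case: insub.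
have ac : forall (i : nat) g0, (i < size gs)%N ->
    let: (_, a, b) := nth g0 gs i in operand_below i a && operand_below i b.
  by case=> [|[|[|i]]] g0 //= _; rewrite ?bel.
have val : operand_below (size gs) (InternalGate F l 2) by [].
exists (Circuit ac val) => //.
have E vals k' : operand_poly vals (var_op k') = var k'.
  by rewrite /var /var_op; case: insub.
rewrite /circuit_poly /= /gates_polys /= !E; congr (_ + _).
by rewrite mpolyCN mpolyC1 mulN1r; case: op {gs ac val}.
Qed.

End SeedVariables.

Lemma ext_lt (T : Type) n (x : 'I_n -> T) y k (kn : (k < n)%N) :
  ext x y (inord k) = x (Ordinal kn).
Proof.
have -> : inord k = lift ord_max (Ordinal kn).
  by apply: val_inj; rewrite /= inordK ?ltnS ?(ltnW kn) // /bump leqNgt kn.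
by rewrite /ext liftK.
Qed.

Lemma ext_last (T : Type) n (x : 'I_n -> T) y : ext x y (inord n) = y.
Proof.
have -> : inord n = ord_max :> 'I_n.+1 by apply: val_inj; rewrite /= inordK.
by rewrite /ext unlift_none.
Qed.

(** * The generator and the hybrid argument *)

Section Generator.
Variables (F : fieldType) (m : nat) (C : circuit F m) (t : nat).
Let gs := gates C.
Let out := output C.
Let s := size gs.
Let N := (3 * s).+1.
Let g0 := (PlusGate, out, out).

(** Each of the [t] blocks turns [N] seeds into [N.+1] coordinates. After the blocks the coordinates
    are [t] ahead of the seeds, hence the index [j - t]. *)
Definition gen_coord (R : comNzRingType) (y : nat -> R) (j : nat) : R :=
  if (j < t * N.+1)%N then
    block_coord gs out (fun i => y (j %/ N.+1 * N + i)%N) (j %% N.+1)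
  else y (j - t)%N.

Definition generator (l n : nat) : poly_map F l n :=
  [tuple gen_coord (@var F l) j | j < n].

Lemma gen_coord_morph (R R' : comNzRingType) (f : {rmorphism R -> R'}) (y : nat -> R) j :
  f (gen_coord y j) = gen_coord (f \o y) j.
Proof. by rewrite /gen_coord; case: ifP => // _; rewrite block_coord_morph. Qed.

Lemma local_gen_coord l j : local_poly (gen_coord (@var F l) j).
Proof.
rewrite /gen_coord; case: ifP => _; last exact: local_var.
rewrite /block_coord; case: ifP => _.
  by case: out => [?|?|?] /=; apply: local_var.
case: ifP => _; last exact: local_var.
case: (nth _ _ _) => [[op a] b] /=.
have E k (a' : operand F m) : exists k',
    slot_val (fun i => var F l (j %/ N.+1 * N + (3 * i).+2)) (var F l k) a'
    = var F l k'.
  by case: a' => [?|?|i] /=; [exists k|exists k|eexists].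
have [k1 ->] := E (j %/ N.+1 * N + (j %% N.+1 - 2))%N a.
have [k2 ->] := E (j %/ N.+1 * N + (j %% N.+1 - 1))%N b.
exact: local_gate.
Qed.

Let acyclic : forall i, (i < size gs)%N ->
  let: (_, a, b) := nth g0 gs i in operand_below i a && operand_below i b.
Proof. by move=> i; apply: gates_acyclic. Qed.

Let valid : operand_below (size gs) out.
Proof. exact: output_valid. Qed.

Definition good_block (v : nat -> F) (q : nat) : Prop :=
  v (q * N.+1 + N)%N = run_out gs out (fun i => v (q * N.+1 + i)%N).

(** Blocks use disjoint seeds, so the preimages of single blocks given by [block_seed] can be
    combined. *)
Lemma gen_coord_onto (l n : nat) (v : nat -> F) :
  (l + t = n)%N -> (t * N.+1 <= n)%N ->
  (forall q, (q < t)%N -> good_block v q) ->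
  exists w : nat -> F, forall j, (j < n)%N ->
    (gen_coord (@var F l) j).@[fun i : 'I_l => w i] = v j.
Proof.
move=> ltn tn hv.
pose w k := if (k < t * N)%N then
    block_seed gs (fun i => v (k %/ N * N.+1 + i)%N) (k %% N) else v (k + t)%N.
exists w => j jn; rewrite gen_coord_morph /gen_coord.
case: ltnP => jt; last first.
  rewrite /= varE /w; last by lia.
  by rewrite ifN ?subnK; [|nia..].
have qt : (j %/ N.+1 < t)%N by rewrite ltn_divLR.
set q := (j %/ N.+1)%N in qt *.
have oN : (j %% N.+1 < N.+1)%N by rewrite ltn_mod.
rewrite (block_coord_ext acyclic valid (y' := block_seed gs (fun i => v (q * N.+1 + i)%N))) //.
  rewrite block_solve //; last exact: hv.
  by rewrite -divn_eq.
move=> k kN; rewrite /= varE; last by rewrite /N in kN tn *; nia.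
rewrite /w ifT; last by rewrite -/N in kN; nia.
by rewrite divnMDl // modnMDl divn_small // addn0 modn_small.
Qed.

(** Blocks are forced onto the graph one after the other, starting from a point where [P] is
    nonzero. With all [t] blocks on the graph the point lies in the image and [P] vanishes, so some
    block [q] is critical; freeing only this block gives [Q]. *)
Lemma hybrid (l n W L D : nat) (P : {mpoly F[n]}) :
  [pchar F] =i pred0 ->
  (l + t = n)%N -> (t * N.+1 <= n)%N -> P != 0 -> P \mPo generator l n = 0 ->
  imm W L P -> (msize P <= D.+1)%N ->
  exists Q : {mpoly F[N.+1]},
  [/\ Q != 0, forall x, Q.@[ext x ((run_out gs out (@var F N)).@[x])] = 0,
      imm W L Q & (msize Q <= D.+1)%N].
Proof.
move=> F0 ltn tn P0 PG immP degP.
pose ev (v : nat -> F) := P.@[fun j : 'I_n => v j].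
pose S q (v : nat -> F) := forall q', (q' < q)%N -> good_block v q'.
have S0 : exists2 v, S 0%N v & ev v != 0.
  have [v hv] := mpoly_neq0_eval F0 P0.
  exists (fun j => if insub j is Some i then v i else 0) => //.
  by rewrite /ev; under meval_eq => i do rewrite valK.
have St v : S t v -> ev v = 0.
  move=> hv; have [w hw] := gen_coord_onto ltn tn hv.
  have := congr1 (meval (fun i : 'I_l => w i)) PG.
  rewrite meval0 comp_mpoly_meval => <-; apply: meval_eq => j.
  by rewrite tnth_mktuple hw.
have [q [qt [v Sv Pv] Sq1]] : exists q, [/\ (q < t)%N, exists2 v, S q v & ev v != 0 &
    forall v, S q.+1 v -> ev v = 0].
  apply: contrapT => hno.
  have : forall q, (q <= t)%N -> exists2 v, S q v & ev v != 0.
    elim=> [|q IH] qt; first exact: S0.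
    apply: contrapT => hq; apply: hno; exists q; split=> //; first exact: IH (ltnW qt).
    by move=> v Sv; apply/eqP/negPn/negP => hv; apply: hq; exists v.
  by move=> /(_ t (leqnn t)) [v /St ->]; rewrite eqxx.
pose inb j := (q * N.+1 <= j < q * N.+1 + N.+1)%N.
(* All coordinates outside block [q] are frozen at the scalars of [v], so the substitution is
   affine. *)
pose lq : n.-tuple {mpoly F[N.+1]} :=
  [tuple if inb j then 'X_(inord (j - q * N.+1)) else (v j)%:MP | j < n].
have aff i : (msize (tnth lq i) <= 2)%N.
  by rewrite tnth_mktuple; case: ifP => _; rewrite ?msizeX ?mdeg1 ?msizeC_le2.
pose v' (u : 'I_N.+1 -> F) j := if inb j then u (inord (j - q * N.+1)) else v j.
have QE u : (P \mPo lq).@[u] = ev (v' u).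
  rewrite comp_mpoly_meval; apply: meval_eq => j; rewrite tnth_mktuple /v'.
  by case: ifP => _; rewrite ?mevalXU ?mevalC.
exists (P \mPo lq); split.
- apply: contraNneq Pv => h.
  have := QE (fun i => v (q * N.+1 + i)%N); rewrite h meval0 => ->.
  apply/eqP; apply: meval_eq => j; rewrite /v'; case: ifP => // /andP[h1 h2].
  by rewrite inordK ?subnKC //; lia.
- move=> x; rewrite QE; apply: Sq1 => q' q'q; rewrite /good_block.
  have [->|qq'] := eqVneq q' q.
    have -> : v' (ext x (run_out gs out (@var F N)).@[x]) (q * N.+1 + N)%N
        = (run_out gs out (@var F N)).@[x].
      rewrite /v' ifT; last by rewrite /inb; lia.
      by rewrite addKn ext_last.
    rewrite run_out_morph; apply: run_out_ext => k kN /=.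
    rewrite /v' ifT; last by rewrite /inb -/N in kN *; lia.
    by rewrite addKn /var /var_op insubT /= mevalXU ext_lt.
  have q'lt : (q' < q)%N by rewrite ltn_neqAle qq'.
  have out_b k : (k < N.+1)%N -> 
      v' (ext x (run_out gs out (@var F N)).@[x]) (q' * N.+1 + k)%N
      = v (q' * N.+1 + k)%N.
    by move=> kN; rewrite /v' ifN // /inb; nia.
  rewrite out_b // (Sv _ q'lt); apply: run_out_ext => k kN.
  by rewrite out_b // ltnW.
- exact: imm_comp.
- exact: msize_affine_comp.
Qed.

End Generator.

(** * Parameters *)

(** The left side is the vertex count of [abp_of_imm] for the width and length in [imm_root], when
    [Q] has width [S.+1] and length [S]. *)
Lemma size_bound (S D : nat) (X := (S + D + 2)%N) (K := (D.+2 * D.+2)%N)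
    (M := (K * D).+1) :
  ((K * S.+1).+1 * (D.+1 * (K.+1 * (M * (M * (S.+1 + 1))))).+1 + 2 <= X ^ 20)%N.
Proof.
have X2 : (2 <= X)%N by rewrite /X; lia.
have pX i j : (i <= j)%N -> (X ^ i <= X ^ j)%N by move=> ij; rewrite leq_exp2l //; lia.
have sX i x : (x <= X ^ i)%N -> (x.+1 <= X ^ i.+1)%N.
  by move=> h; rewrite expnS; move: (expn_gt0 X i); nia.
have mX i j x y : (x <= X ^ i)%N -> (y <= X ^ j)%N -> (x * y <= X ^ (i + j))%N.
  by move=> h1 h2; rewrite expnD leq_mul.
have hD : (D.+2 <= X ^ 1)%N by rewrite expn1 /X; lia.
have hD1 : (D.+1 <= X ^ 1)%N by rewrite expn1 /X; lia.
have hD0 : (D <= X ^ 1)%N by rewrite expn1 /X; lia.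
have hS : (S.+1 + 1 <= X ^ 1)%N by rewrite expn1 /X; lia.
have hS1 : (S.+1 <= X ^ 1)%N by rewrite expn1 /X; lia.
have hK : (K <= X ^ 2)%N by exact: (mX 1 1)%N.
have hM : (M <= X ^ 4)%N by apply/sX/(mX 2 1).
have h1 : ((K * S.+1).+1 <= X ^ 4)%N by apply/sX/(mX 2 1).
have h2 : ((D.+1 * (K.+1 * (M * (M * (S.+1 + 1))))).+1 <= X ^ 14)%N.
  apply/sX/(mX 1 12) => //; apply: (mX 3 9); first exact: sX.
  by apply: (mX 4 5) => //; apply: (mX 4 1).
apply: (@leq_trans (X ^ 18 + 2)); first by rewrite leq_add2r (mX 4 14).
by rewrite addn2; apply/sX/sX.
Qed.

(** The small program of [P] passes to [Q] and to its root, the perturbed output; specializing the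
    slots then yields the polynomial of the circuit. *)
Lemma abp_of_vanishing (F : fieldType) (m t l n S D : nat) (C : circuit F m)
    (P : {mpoly F[n]}) (B : abp F n S) :
  [pchar F] =i pred0 ->
  (l + t = n)%N -> (t * (3 * circuit_size C).+2 <= n)%N ->
  P != 0 -> P \mPo generator C t l n = 0 ->
  abp_poly B = P -> (msize P <= D.+1)%N ->
  exists2 k, (k <= (S + D + 2) ^ 20)%N & exists B' : abp F m k, abp_poly B' = circuit_poly C.
Proof.
move=> F0 ltn tn P0 PG EB degP.
have immP : imm S.+1 S P by rewrite -EB; apply: imm_of_abp.
have [Q [Q0 Qv immQ degQ]] := hybrid F0 ltn tn P0 PG immP degP.
set N := (3 * size (gates C)).+1 in Q Q0 Qv immQ degQ.
pose gs := gates C; pose out := output C.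
pose sg := [tuple circuit_inputs gs out i | i < N].
have aff i : (msize (tnth sg i) <= 2)%N.
  by rewrite tnth_mktuple; apply: msize_circuit_inputs.
have := imm_root F0 aff Q0 Qv immQ degQ.
have -> : run_out gs out (@var F N) \mPo sg = circuit_poly C.
  rewrite [LHS]run_out_morph /circuit_poly -run_circuit; apply: run_out_ext => k kN.
  by rewrite /= /var /var_op insubT /= comp_mpolyXU -tnth_nth tnth_mktuple.
rewrite add1n => /abp_of_imm [B' EB'].
by eexists; [exact: size_bound|exists B'].
Qed.

Lemma seed_length_le (R : realType) (eps : R) n : (seed_length eps n <= n)%N.
Proof.
rewrite /seed_length truncn_le_nat -natr1.
by have := powR_ge0 (n%:R : R) (1 - eps); lra.
Qed.

(** For an integer [E > 1 / eps], [n^(1 - eps)] is at most [n^(1 - 1/E)], and the [E]-th power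
    leaves an inequality in natural numbers. The factor [2] absorbs the rounding. *)
Lemma stretch_bound (R : realType) (eps : R) : 0 < eps ->
  exists2 E, (0 < E)%N & forall n, (0 < n)%N ->
    ((n - seed_length eps n) ^ E <= 2 ^ E * n ^ E.-1)%N.
Proof.
move=> eps0; exists (Num.truncn eps^-1).+1 => // n n0.
set E := (Num.truncn _).+1.
have En0 : 0 < E%:R :> R by rewrite ltr0n.
have Eeps : E%:R^-1 <= eps.
  rewrite -[leRHS]invrK lef_pV2 ?posrE ?invr_gt0 //.
  exact/ltW/truncnS_gt.
have E1 : E%:R^-1 <= 1 :> R by rewrite invf_le1 // ler1n.
have n1 : 1 <= n%:R :> R by rewrite ler1n.
pose y : R := n%:R `^ (1 - E%:R^-1).
have y1 : 1 <= y by rewrite -(powRr0 n%:R) ler_powR // subr_ge0.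
have ny : n%:R `^ (1 - eps) <= y by rewrite ler_powR // lerD2l lerN2.
set l := seed_length eps n.
have lt : (n - l)%N%:R <= 2 * y :> R.
  rewrite natrB ?seed_length_le //.
  have := truncnS_gt (n%:R - n%:R `^ (1 - eps)); rewrite -/(seed_length eps n) -/l -natr1.
  by lra.
have yE : y ^+ E = n%:R ^+ E.-1.
  rewrite -!powR_mulrn ?powR_ge0 // /y -powRrM mulrBl mul1r mulVf ?gt_eqF //.
  by rewrite -[E in LHS]/(E.-1.+1) -natr1 addrK.
rewrite -(ler_nat R) natrM !natrX -yE -exprMn.
by rewrite lerXn2r // ?nnegrE ?ler0n // mulr_ge0 //; lra.
Qed.

Lemma poly_bounded_le s : poly_bounded s -> exists e, forall n, (s n <= n.+2 ^ e)%N.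
Proof.
move=> [c hc]; exists c.+1 => n; apply: leq_trans (hc n) _.
have h1 : (n ^ c <= n.+2 ^ c)%N by case: (c) => // c'; rewrite leq_exp2r //; lia.
have h2 : (c <= n.+2 ^ c)%N by apply: ltnW; apply: ltn_expl.
by rewrite expnS; nia.
Qed.

(** Here [B k] bounds the block length for [f_k], and the largest [k] that fits is taken. As
    [t b <= n] once [(2 b)^E <= n], maximality bounds [n] by a power of [B k.+1]. The cap [k <= n]
    makes the maximum exist. *)
Lemma block_count_bound (E t n : nat) (B : nat -> nat) : (0 < E)%N ->
  (t ^ E <= 2 ^ E * n ^ E.-1)%N -> ((2 * B 0) ^ E < n)%N ->
  exists2 k, (t * B k <= n)%N & (n <= k)%N \/ (n < (2 * B k.+1) ^ E)%N.
Proof.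
move=> E0 tE hn.
have nE : (n ^ E = n * n ^ E.-1)%N by rewrite -expnS prednK.
have n0 : (0 < n)%N by apply: leq_ltn_trans hn.
have nE0 : (0 < n ^ E.-1)%N by rewrite expn_gt0 n0.
have tB b : ((t * b) ^ E <= (2 * b) ^ E * n ^ E.-1)%N.
  by rewrite !expnMn mulnAC leq_mul2r tE orbT.
have ex : exists k, (t * B k <= n)%N && (k <= n)%N.
  exists 0%N; rewrite andbT -(leq_exp2r _ _ E0) nE.
  by apply: leq_trans (tB _) _; rewrite leq_mul2r (ltnW hn) orbT.
have bd k : (t * B k <= n)%N && (k <= n)%N -> (k <= n)%N by case/andP.
case: (ex_maxnP ex bd) => k /andP[tk kn] kmax; exists k => //.
case: (leqP n k) => nk; [by left|right].
have : ~~ (t * B k.+1 <= n)%N.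
  by apply/negP => h; have := kmax k.+1; rewrite h nk ltnn => /(_ isT).
rewrite -ltnNge -(ltn_exp2r _ _ E0) nE => h.
by rewrite -(ltn_pmul2r nE0); apply: leq_trans h (tB _).
Qed.

Lemma local_in_VNC0 (F : fieldType) (f : poly_seq F) :
  (forall n, local_poly (f n)) -> VNC0 f.
Proof.
move=> h; split; last by exists 3%N => n; have [_ [C ? ?]] := h n; exists C.
by exists 2%N => n; have [hs _] := h n; move: (msize _) hs => k; lia.
Qed.

Lemma block_size_bound d k : ((2 * (3 * (k.+1 ^ d + d)).+2) <= (k + 3) ^ (d + 4))%N.
Proof.
have h1 : (k.+1 ^ d <= (k + 3) ^ d)%N by case: (d) => // d'; rewrite leq_exp2r //; lia.
have h2 : (d.+1 <= (k + 3) ^ d)%N by apply: ltn_expl; lia.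
have h3 : (81 <= (k + 3) ^ 4)%N by rewrite -[81%N]/(3 ^ 4)%N leq_exp2r //; lia.
by rewrite expnD; nia.
Qed.

Theorem theorem4p9 (F : fieldType) (R : realType) (eps : R) :
  [pchar F] =i pred0 ->
  0 < eps ->
  (exists f : poly_seq F, VP f /\ requires_superpoly_abps f) ->
  exists G : forall n : nat, poly_map F (seed_length eps n) n,
    hitting_set_generator (@VNC0 F) (@VBP F) G.
Proof.
move=> F0 eps0 [f [[_ [s [d hd] cs]] hard]].
pose C k := s2val (cid2 (cs k)).
have Cf k : circuit_poly (C k) = f k by rewrite /C; case: cid2.
have Cs k : (circuit_size (C k) <= k ^ d + d)%N.
  by apply: leq_trans (hd k); rewrite /C; case: cid2.
pose B k := (3 * (k ^ d + d)).+2.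
have [E E0 hE] := stretch_bound eps0.
pose t n := (n - seed_length eps n)%N.
(* The [n]-th map uses the circuit of [f_k] with [k = kf n], polynomially large in [n] beyond the
   threshold. *)
have /choice[kf hkf] : forall n, exists k, ((2 * B 0%N) ^ E < n)%N ->
    (t n * B k <= n)%N /\ ((n <= k)%N \/ (n < (2 * B k.+1) ^ E)%N).
  move=> n; have [hn|hn] := boolP ((2 * B 0) ^ E < n)%N; last by exists 0%N.
  have n0 : (0 < n)%N by apply: leq_ltn_trans hn.
  by have [k h1 h2] := block_count_bound E0 (hE n n0) hn; exists k.
exists (fun n => generator (C (kf n)) (t n) (seed_length eps n) n); split.
  move=> i _; apply: local_in_VNC0 => n.
  change (local_poly (nth 0 (generator (C (kf n)) (t n) (seed_length eps n) n) (i n))).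
  case: (ltnP (i n) n) => hi; last first.
    by rewrite nth_default ?size_tuple //; exact: (local0 F).
  by rewrite (nth_mktuple _ _ (Ordinal hi)); apply: local_gen_coord.
move=> g [pg [sg psg cg]] [c hc].
have [e1 he1] := poly_bounded_le psg.
have [e2 he2] := poly_bounded_le pg.
(* [V] bounds [n.+2] by a power of [k + 3], [c.+2] bounds [j.+2] by a power of [n.+2], and [e]
   covers size and degree of [g j]. In [Z], [20] comes from [size_bound] and [2] from
   [k + 3 <= k^2]. *)
pose V := ((d + 4) * E).+1; pose e := (e1 + e2 + 2)%N.
pose Z := (2 * (V * (c.+2 * e) * 20))%N.
have [N hN] := hard Z.+1.
pose k0 := maxn 3 N.
(* A larger [j] forces [n > n1]; the first summand then forces [k >= k0], the second meets the
   threshold of [kf]. *)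
pose n1 := ((k0 + 3) ^ V + (2 * B 0) ^ E)%N.
exists (n1 ^ c + c).+1 => j hj; split; last by move->; rewrite comp_mpoly0.
set n := nvars g j => PG; apply/eqP/negPn/negP => P0.
have n1n : (n1 < n)%N.
  rewrite ltnNge; apply/negP => nn1.
  have : (n ^ c <= n1 ^ c)%N by case: (c) => // c'; rewrite leq_exp2r.
  by have := hc j; rewrite -/n; lia.
have [|tB hk] := hkf n; first by apply: leq_ltn_trans n1n; rewrite leq_addl.
set k := kf n in PG tB hk.
have nk : (n.+2 <= (k + 3) ^ V)%N.
  rewrite /V expnS mulnC expnM; case: hk => [nk|nk].
    have h : (k + 3 <= ((k + 3) ^ (d + 4)) ^ E)%N.
      by rewrite -expnM -[X in (X <= _)%N]expn1 leq_exp2l ?muln_gt0 ?E0 //; lia.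
    by nia.
  have h := block_size_bound d k.
  rewrite -(leq_exp2r _ _ E0) in h; have := leq_trans nk h.
  by move: (_ ^ E)%N => x; nia.
have k0k : (k0 <= k)%N.
  rewrite leqNgt; apply/negP => kk.
  have : ((k + 3) ^ V <= (k0 + 3) ^ V)%N by rewrite leq_exp2r //; lia.
  by rewrite /n1 in n1n; lia.
have [S hS [A EA]] := cg j.
have tBk : (t n * (3 * circuit_size (C k)).+2 <= n)%N.
  by apply: leq_trans tB; rewrite leq_mul2l /B !ltnS leq_mul2l Cs !orbT.
have := abp_of_vanishing F0 (subnKC (seed_length_le eps n)) tBk P0 PG EA (leqSpred _).
move=> [k' hk' [A' EA']].
(* Hardness of [f_k] demands [k ^ Z.+1] vertices, while the program found has at most [k ^ Z]. *)
have := hN k (leq_trans (leq_maxr _ _) k0k) k' A' (etrans EA' (Cf k)).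
apply/negP; rewrite -ltnNge; apply: leq_ltn_trans hk' _.
have k3 : (3 <= k)%N by apply: leq_trans k0k; apply: leq_maxl.
have jn : (j.+2 <= n.+2 ^ c.+2)%N.
  have h1 : (n ^ c <= n.+2 ^ c)%N by case: (c) => // c'; rewrite leq_exp2r //; lia.
  have h2 : (c < n.+2 ^ c)%N by apply: ltn_expl.
  have := hc j; rewrite -/n !expnS; nia.
have XS : (S + (msize (g j)).-1 + 2 <= j.+2 ^ e)%N.
  have h1 := leq_trans hS (he1 j); have h2 := he2 j.
  have h3 : (j.+2 ^ e1 <= j.+2 ^ (e1 + e2))%N by rewrite leq_exp2l // leq_addr.
  have h4 : (j.+2 ^ e2 <= j.+2 ^ (e1 + e2))%N by rewrite leq_exp2l // leq_addl.
  have h5 : (0 < j.+2 ^ (e1 + e2))%N by rewrite expn_gt0.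
  by rewrite /e expnD; nia.
apply: (@leq_ltn_trans (k ^ Z)); last by rewrite ltn_exp2l //; lia.
rewrite /Z expnM [X in (_ <= X)%N]expnM leq_exp2r //.
apply: leq_trans XS _; rewrite expnM.
have e0 : (0 < e)%N by rewrite /e addn2.
apply: (@leq_trans (((k + 3) ^ V) ^ (c.+2 * e))).
  rewrite [X in (_ <= X)%N]expnM leq_exp2r //.
  by apply: leq_trans jn _; rewrite leq_exp2r.
rewrite leq_exp2r; last by rewrite muln_gt0.
by rewrite leq_exp2r //; nia.
Qed.
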